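(* Let $\mathbb{X}$ be either $L_p[0,1]$ with $1\le p\le\infty$, or $C[0,1]$, or $D[0,1]$. Let $\bm\theta_0\in\mathbb{X}$, let $k\in\mathbb N$ be fixed, let $\bm\alpha=(\alpha_x)_{x\in[0,1]}$ with $\alpha_x\in(0,1)$, and let $T_{P,\bm\alpha,n,k}=\mathbf q_{P,\bm\alpha}(Z^{(1)}_{\lfloor n/k\rfloor},\dots,Z^{(k)}_{\lfloor n/k\rfloor})$. (1) If $Z_n\stackrel{p}{\to}\bm\theta_0$ as $n\to\infty$, then $T_{P,\bm\alpha,n,k}\stackrel{p}{\to}\bm\theta_0$ as $n\to\infty$. (2) If $a_n(Z_n-\bm\theta_0)\stackrel{d}{\to}Y$ as $n\to\infty$, for some sequence $(a_n)_{n\in\mathbb N}$ of non-negative numbers going to infinity and some $\mathbb X$-valued random variable $Y$, then $a_{\lfloor n/k\rfloor}(T_{P,\bm\alpha,n,k}-\bm\theta_0)\stackrel{d}{\to}\mathbf q_{P,\bm\alpha}(Y_1,\dots,Y_k)$ as $n\to\infty$, where $Y_1,\dots,Y_k$ are i.i.d. copies of $Y$.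
   Context: Univariate quantile: for $\alpha\in(0,1)$ and $\mathbf x\in\mathbb R^k$ with increasingly ordered components $\tilde x_1\le\dots\le\tilde x_k$, $q_\alpha(\mathbf x)=\frac12(\tilde x_{\lceil k\alpha\rceil}+\tilde x_{\lfloor k\alpha+1\rfloor})$. Point-wise component-wise quantile: for $\mathbf f_1,\dots,\mathbf f_k\in\mathbb X$ and $x\in[0,1]$, $\mathbf q_{P,\bm\alpha}(\mathbf f_1,\dots,\mathbf f_k)(x)=q_{\alpha_x}(\mathbf f_1(x),\dots,\mathbf f_k(x))$. $C[0,1]$ (continuous functions) and $D[0,1]$ (c\`adl\`ag functions) are endowed with the supremum norm. Estimators: the data are i.i.d. observations. For each $m$, $Z_m$ is an $\mathbb X$-valued estimator of the parameter $\bm\theta_0$, i.e. a random element obtained by applying a fixed map to $m$ observations. A sample of $n$ i.i.d. observations is divided into $k$ disjoint blocks of equal size $\lfloor n/k\rfloor$, and $Z^{(i)}_{\lfloor n/k\rfloor}$ denotes the estimator computed from the observations in block $i$, $i=1,\dots,k$. There is no contamination of the sample in this statement.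
   Formalization: In (2) the formal theorem also assumes that the quantile map sends X^k into X (false for some α, e.g. a jump in α on C[0,1], where T leaves X) and, for nonseparable X (L_∞, D), that Y is a.s. separably valued; convergence in distribution is taken with outer expectations. *)

(* Defs.v *)
From HB Require Import structures.
From mathcomp Require Import all_boot all_order all_algebra.
From mathcomp Require Import all_classical all_reals all_analysis.
Set Implicit Arguments.
Unset Strict Implicit.
Unset Printing Implicit Defensive.
Import Order.TTheory GRing.Theory Num.Theory.
Import numFieldNormedType.Exports.
Local Open Scope classical_set_scope.
Local Open Scope ring_scope.

(* [order_stat x j] is the j-th smallest component, with j counted from 1. *)
Definition order_stat (R : realType) (k : nat) (x : 'I_k -> R) (j : nat) : R :=
  nth 0 (sort <=%R [seq x i | i <- enum 'I_k]) j.-1.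

(* For 0 < a < 1 both indices lie in {1, ..., k}, so [absz] only casts a
   positive integer to nat. *)
Definition quantile (R : realType) (k : nat) (a : R) (x : 'I_k -> R) : R :=
  (order_stat x `|Num.ceil (k%:R * a)|%N +
   order_stat x `|Num.floor (k%:R * a + 1)|%N) / 2.

(* Functions on [0, 1] are represented by functions on R of which only the
   values on [0, 1] matter. *)
Definition pquantile (R : realType) (k : nat) (alpha : R -> R)
    (f : 'I_k -> R -> R) : R -> R :=
  fun x => quantile (alpha x) (fun i => f i x).

Inductive fspace (R : realType) : Type :=
| Lp01 (p : \bar R) of (1 <= p)%E
| C01
| D01.
Arguments C01 {R}.
Arguments D01 {R}.

Definition cadlag (R : realType) (f : R -> R) : Prop :=
  (forall x, x \in `[0, 1[ -> f y @[y --> x^'+] --> f x) /\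
  (forall x, x \in `]0, 1] -> cvg (f y @[y --> x^'-])).

(* [f \_ `[0, 1]] extends f by 0, so that its Lebesgue L_p-norm over R is the
   L_p-norm over [0, 1].  L_p[0, 1] is handled through its elements'
   representatives: [fnorm] is a seminorm, and every notion below is stated
   through [fnorm], hence is compatible with almost everywhere equality. *)
Definition mem_fspace (R : realType) (X : fspace R) : set (R -> R) :=
  match X with
  | Lp01 p _ => [set f : R -> R | f \_ `[0, 1] \in Lfun (@lebesgue_measure R) p]
  | C01 => [set f : R -> R | {within `[0, 1], continuous f}]
  | D01 => [set f : R -> R | cadlag f]
  end.

Definition fnorm (R : realType) (X : fspace R) (f : R -> R) : \bar R :=
  match X with
  | Lp01 p _ => 'N[@lebesgue_measure R]_p [EFin \o f \_ `[0, 1]]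
  | C01 | D01 => ereal_sup [set `|f x|%:E | x in `[0, 1]]
  end.

Definition fdist (R : realType) (X : fspace R) (f g : R -> R) : \bar R :=
  fnorm X (f \- g).

Definition open_fspace (R : realType) (X : fspace R) (U : set (R -> R)) : Prop :=
  U `<=` mem_fspace X /\
  forall f, U f -> exists2 e : R, 0 < e &
    forall g, mem_fspace X g -> (fdist X g f < e%:E)%E -> U g.

Definition borel_fspace (R : realType) (X : fspace R) : set (set (R -> R)) :=
  <<s mem_fspace X, open_fspace X >>.

Definition bounded_continuous (R : realType) (X : fspace R)
    (h : (R -> R) -> R) : Prop :=
  (exists M : R, forall f, mem_fspace X f -> `|h f| <= M) /\
  forall f, mem_fspace X f -> forall e : R, 0 < e ->
    exists2 d : R, 0 < d & forall g, mem_fspace X g ->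
      (fdist X g f < d%:E)%E -> `|h g - h f| < e.

Definition dense_seq (R : realType) (X : fspace R) (D : nat -> R -> R) : Prop :=
  (forall n, mem_fspace X (D n)) /\
  forall f, mem_fspace X f -> forall e : R, 0 < e ->
    exists n, (fdist X f (D n) < e%:E)%E.

Definition separable (R : realType) (X : fspace R) : Prop :=
  exists D, dense_seq X D.

(* Used with the domain T of Z either a sample space or a space of data. *)
Definition random_element (R : realType) (X : fspace R) (d : measure_display)
    (T : measurableType d) (Z : T -> R -> R) : Prop :=
  (forall w, mem_fspace X (Z w)) /\
  forall B, borel_fspace X B -> measurable (Z @^-1` B).

Definition ae_separably_valued (R : realType) (X : fspace R)
    (d : measure_display) (T : measurableType d) (P : probability T R)
    (Y : T -> R -> R) : Prop :=
  exists2 D : nat -> R -> R, forall n, mem_fspace X (D n) &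
    {ae P, forall w, forall e : R, 0 < e ->
      exists n, (fdist X (Y w) (D n) < e%:E)%E}.

Definition outer_expectation (R : realType) (d : measure_display)
    (T : measurableType d) (P : probability T R) (f : T -> R) : \bar R :=
  ereal_inf [set 'E_P[g]%E | g in
    [set g : T -> R | P.-integrable setT (EFin \o g) /\ forall w, f w <= g w]].

(* In D[0, 1] and L_oo[0, 1], which are not separable, a function of several
   Borel random elements need not be Borel measurable.  Convergence is therefore
   taken in the Hoffmann-Jorgensen sense, with the outer probability [mu_ext P]
   and the outer expectation; on measurable arguments these are P and 'E_P. *)
Definition cvg_in_prob (R : realType) (X : fspace R) (d : measure_display)
    (T : measurableType d) (P : probability T R) (Z : nat -> T -> R -> R)
    (theta : R -> R) : Prop :=
  forall e : R, 0 < e ->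
    mu_ext P [set w | (e%:E < fdist X (Z n w) theta)%E] @[n --> \oo] --> 0%E.

Definition cvg_in_dist (R : realType) (X : fspace R) (d d' : measure_display)
    (T : measurableType d) (P : probability T R) (Z : nat -> T -> R -> R)
    (T' : measurableType d') (P' : probability T' R) (Y : T' -> R -> R) : Prop :=
  forall h : (R -> R) -> R, bounded_continuous X h ->
    outer_expectation P (fun w => h (Z n w)) @[n --> \oo] -->
    outer_expectation P' (fun w => h (Y w)).

(* In the next two definitions F is the sigma-algebra of the target space E. *)
Definition independent (R : realType) (d : measure_display)
    (T : measurableType d) (P : probability T R) (I : eqType) (E : Type)
    (F : set (set E)) (V : I -> T -> E) : Prop :=
  forall (J : seq I) (A : I -> set E), uniq J -> (forall i, F (A i)) ->
    P (\bigcap_(i in [set` J]) V i @^-1` A i) =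
    (\prod_(i <- J) P (V i @^-1` A i))%E.

Definition iid (R : realType) (d : measure_display)
    (T : measurableType d) (P : probability T R) (I : eqType) (E : Type)
    (F : set (set E)) (V : I -> T -> E) : Prop :=
  [/\ forall i A, F A -> measurable (V i @^-1` A),
      forall i j A, F A -> P (V i @^-1` A) = P (V j @^-1` A) &
      independent P F V].

Definition iid_copies (R : realType) (X : fspace R) (d d' : measure_display)
    (T : measurableType d) (P : probability T R) (Y : T -> R -> R)
    (T' : measurableType d') (P' : probability T' R) (k : nat)
    (Y' : 'I_k -> T' -> R -> R) : Prop :=
  [/\ forall i, random_element X (Y' i),
      forall i B, borel_fspace X B -> P' (Y' i @^-1` B) = P (Y @^-1` B) &
      independent P' (borel_fspace X) Y'].

Definition estimator (R : realType) (S Omega : Type)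
    (t : forall m, m.-tuple S -> R -> R) (xi : nat -> Omega -> S)
    (n : nat) : Omega -> R -> R :=
  fun w => t n [tuple xi j w | j < n].

(* [b n (i, j)] is the index, in the sample of size n, of the j-th observation
   of block i; the blocks are disjoint when [b n] is injective. *)
Definition block_estimator (R : realType) (S Omega : Type)
    (t : forall m, m.-tuple S -> R -> R) (xi : nat -> Omega -> S) (k : nat)
    (b : forall n, 'I_k * 'I_(n %/ k) -> 'I_n) (n : nat) (i : 'I_k) :
    Omega -> R -> R :=
  fun w => t (n %/ k)%N [tuple xi (b n (i, j)) w | j < n %/ k].

Definition quantile_estimator (R : realType) (S Omega : Type)
    (t : forall m, m.-tuple S -> R -> R) (xi : nat -> Omega -> S) (k : nat)
    (b : forall n, 'I_k * 'I_(n %/ k) -> 'I_n) (alpha : R -> R) (n : nat) :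
    Omega -> R -> R :=
  fun w => pquantile alpha (fun i : 'I_k => block_estimator t xi b n i w).

(* Main.v *)
Require Import Defs.
From mathcomp Require Import all_boot all_order all_algebra.
From mathcomp Require Import all_classical all_reals all_analysis.
From mathcomp Require Import measurable_realfun ess_sup_inf.
From mathcomp Require Import ring lra.
Import Order.TTheory GRing.Theory Num.Theory.
Import numFieldNormedType.Exports.
Local Open Scope classical_set_scope.
Local Open Scope ring_scope.

(** Both claims rest on one pointwise estimate: for a fixed level, the quantile
    of k numbers is monotone, commutes with nondecreasing affine maps, and hence
    moves by at most the sum of the displacements of its arguments
    ([quantile_lipschitz]).  Integrated over [0, 1] this makes the componentwise
    quantile Lipschitz from k copies of the function space to the space
    ([fdist_pquantile]), and constant functions being fixed points it bounds the
    distance of the quantile to [theta0] by the sum of the distances of its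
    arguments ([fdist_pquantile_cst]).

    Consistency follows by a union bound.  The quantile estimator is far from
    [theta0] only if one of the k block estimators is; the blocks have the same
    law as the first n %/ k observations ([sub_sample_law]), and n %/ k tends to
    infinity.

    For the limit law, affine equivariance turns the rescaled quantile estimator
    into the quantile of the rescaled block estimators, so that, the quantile
    being continuous, it suffices that the k rescaled block estimators converge
    jointly to k independent copies of the limit.  The difficulty is that on a
    nonseparable space a continuous function of several random elements need not
    be measurable, so independence cannot be applied to it directly.  It can be
    applied to a product of functions of one block each, and the limit
    concentrates on a separable set.  Along a countable dense part of that set,
    products of bump functions in the single coordinates give a partition of
    unity, and the partial sums built from it approximate a bounded continuous
    function of k arguments from both sides, up to a remainder which is itself a
    finite combination of products and has small mean under the limit
    ([partition_sum_close], [partition_remainder_cvg0]).  Means of combinations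
    of products converge, by independence of the blocks ([mean_prod_blocks]) and
    of the copies ([mean_prod_random_elements]); sandwiching the outer
    expectations between them gives the joint convergence
    ([cvg_outer_expectation]). *)

(** * Quantiles of finitely many numbers *)

Section order_statistics.
Context {R : realType} {k : nat}.
Implicit Types (x y : 'I_k -> R) (a c d : R).

Let os x := sort <=%R [seq x i | i <- enum 'I_k].

Lemma size_os x : size (os x) = k.
Proof. by rewrite size_sort size_map size_enum_ord. Qed.

(** The j-th smallest value is at most c as soon as j of the values are at most
    c, and lowering the values can only increase that count. *)
Lemma le_order_stat x y j : (forall i, x i <= y i) ->
  (0 < j <= k)%N -> order_stat x j <= order_stat y j.
Proof.
move=> xy /andP[j0 jk]; rewrite /order_stat -/(os x) -/(os y).
have jk1 : (j.-1 < k)%N by rewrite prednK.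
set c := nth 0 (os y) j.-1.
have sx : sorted <=%R (os x) by apply: sort_le_sorted.
have sy : sorted <=%R (os y) by apply: sort_le_sorted.
apply: nth_count_le => //.
have : (j.-1 < count (<= c) (os y))%N.
  rewrite ltnNge; apply/negP => cj.
  suff : c < nth 0 (os y) j.-1 by rewrite ltxx.
  by apply: nth_count_gt => //; rewrite cj size_os.
move=> /leq_trans; apply; rewrite /os !count_sort !count_map.
by apply: sub_count => i /= /(le_trans (xy i)).
Qed.

Lemma order_stat_homo (f : R -> R) x j : {homo f : u v / u <= v} ->
  (0 < j <= k)%N -> order_stat (f \o x) j = f (order_stat x j).
Proof.
move=> fh /andP[j0 jk]; rewrite /order_stat -/(os x) -/(os (f \o x)).
have -> : os (f \o x) = map f (os x).
  rewrite {1}/os; apply: (@le_sorted_eq _ R); first exact: sort_le_sorted.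
    exact/(homo_sorted fh)/sort_le_sorted.
  by rewrite perm_sort (map_comp f x) perm_map// perm_sym perm_sort.
by rewrite (nth_map 0) // size_os prednK.
Qed.

(** As 0 < a < 1 forces 0 < k a < k, both ranks used by the quantile point at
    actual components; every other property of quantiles depends on this. *)
Lemma quantile_indices_bound a : (0 < k)%N -> 0 < a < 1 ->
  (0 < `|Num.ceil (k%:R * a)| <= k)%N /\ (0 < `|Num.floor (k%:R * a + 1)| <= k)%N.
Proof.
move=> k0 /andP[a0 a1].
have k0' : 0 < k%:R :> R by rewrite ltr0n.
have ka0 : 0 < k%:R * a by rewrite mulr_gt0.
have kak : k%:R * a < k%:R by rewrite gtr_pMr.
have c1 : (0 < Num.ceil (k%:R * a))%R by rewrite real_ceil_gt_int ?num_real.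
have c2 : (Num.ceil (k%:R * a) <= k%:Z)%R.
  by rewrite real_ceil_le_int ?num_real// -pmulrn ltW.
have f1 : (1 <= Num.floor (k%:R * a + 1))%R.
  by rewrite real_floor_ge_int ?num_real//= lerDr ltW.
have f2 : (Num.floor (k%:R * a + 1) <= k%:Z)%R.
  rewrite -ltzD1 real_floor_lt_int ?num_real// intrD -pmulrn ltrD2r //.
split; rewrite -!ltz_nat -!lez_nat.
  by rewrite gtz0_abs// c1 c2.
by rewrite gtz0_abs ?f2 ?andbT ?(lt_le_trans _ f1).
Qed.

Lemma le_quantile a x y : (0 < k)%N -> 0 < a < 1 -> (forall i, x i <= y i) ->
  quantile a x <= quantile a y.
Proof.
move=> k0 a01 xy; have [h1 h2] := quantile_indices_bound _ k0 a01.
by rewrite /quantile ler_pM2r ?invr_gt0// lerD// le_order_stat.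
Qed.

Lemma quantile_affine a x c d : (0 < k)%N -> 0 < a < 1 -> 0 <= c ->
  quantile a (fun i => c * x i + d) = c * quantile a x + d.
Proof.
move=> k0 a01 c0; have [h1 h2] := quantile_indices_bound _ k0 a01.
rewrite /quantile.
have E j : (0 < j <= k)%N ->
    order_stat (fun i => c * x i + d) j = c * order_stat x j + d.
  move=> hj; rewrite -(order_stat_homo (fun u => c * u + d))// => u v uv.
  by rewrite lerD2r ler_wpM2l.
by rewrite !E//; lra.
Qed.

(** If every argument moves by at most s, the arguments stay between the
    translates by s in both directions, and so does the quantile. *)
Lemma quantile_lipschitz a x y : (0 < k)%N -> 0 < a < 1 ->
  `|quantile a x - quantile a y| <= \sum_i `|x i - y i|.
Proof.
move=> k0 a01; set s := \sum_i _.
have xys i : `|x i - y i| <= s.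
  by rewrite /s (bigD1 i)//= lerDl sumr_ge0.
have H (u v : 'I_k -> R) : (forall i, `|u i - v i| <= s) ->
    quantile a u <= quantile a v + s.
  move=> h; have := quantile_affine a v 1 s k0 a01 ler01; rewrite mul1r => <-.
  apply: le_quantile => // i; rewrite mul1r addrC -lerBlDr.
  exact: le_trans (ler_norm _) (h i).
rewrite ler_norml; apply/andP; split.
  by rewrite lerBrDr addrC -lerBrDr opprK H// => i; rewrite distrC.
by rewrite lerBlDl H.
Qed.

Lemma quantile_cst a c : (0 < k)%N -> 0 < a < 1 ->
  quantile a (fun _ : 'I_k => c) = c.
Proof.
move=> k0 a01; have := quantile_affine _ (fun _ : 'I_k => 0) 0 c k0 a01 (lexx 0).
by rewrite !mul0r !add0r.
Qed.

End order_statistics.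

(** * The function spaces and their seminorms *)

Section function_spaces.
Context {R : realType} (X : fspace R).
Implicit Types (f g h : R -> R).

Lemma mem01_0 : (0 : R) \in `[0, 1]. Proof. by rewrite in_itv /= lexx ler01. Qed.

Lemma fnorm_ge0 f : (0 <= fnorm X f)%E.
Proof.
have sup0 : (0 <= ereal_sup [set `|f x|%:E | x in `[0%R, 1%R]])%E.
  apply: le_ereal_sup_tmp; exists `|f 0|%:E; last by rewrite lee_fin.
  by exists 0 => //; exact: mem01_0.
case: X => [p p1||] /=; [exact: Lnorm_ge0|exact: sup0..].
Qed.

(** The levels alpha may depend on x in an arbitrary way, so the quantile of
    measurable functions may fail to be measurable; monotonicity of the integral
    still holds because the integral of a nonnegative function is a supremum over
    the simple functions below it. *)
Lemma ge0_le_nonmeasurable_integral d (T : measurableType d)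
    (mu : {measure set T -> \bar R}) (f g : T -> \bar R) :
  (forall x, 0 <= f x)%E -> (forall x, f x <= g x)%E ->
  (\int[mu]_x f x <= \int[mu]_x g x)%E.
Proof.
move=> f0 fg; have g0 x : (0 <= g x)%E by exact: le_trans (fg x).
rewrite !ge0_integralTE//; apply: ereal_sup_le => _ [u /= uf <-].
by exists u => //= x; exact: le_trans (fg x).
Qed.

Lemma le_fnorm f g : (forall x, x \in `[0, 1] -> `|f x| <= `|g x|) ->
  (fnorm X f <= fnorm X g)%E.
Proof.
move=> fg.
have le_sup : (ereal_sup [set `|f x|%:E | x in `[0%R, 1%R]] <=
    ereal_sup [set `|g x|%:E | x in `[0%R, 1%R]])%E.
  apply: ge_ereal_sup => _ [x x01 <-]; apply: le_ereal_sup_tmp.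
  by exists `|g x|%:E; [exists x|rewrite lee_fin fg].
have le_restr x : `|(f \_ `[0, 1]) x| <= `|(g \_ `[0, 1]) x|.
  by rewrite !patchE; case: ifPn => //; rewrite inE => /fg.
case: X => [p p1||] //=.
rewrite unlock /Lnorm; case: p p1 => [p p1||//].
- rewrite lee_fin in p1; have p0 : 0 < p by exact: lt_le_trans p1.
  apply: gt0_ler_poweR; rewrite ?invr_ge0 ?(ltW p0)//.
  + by rewrite in_itv/= leey integral_ge0// => x _; exact: poweR_ge0.
  + by rewrite in_itv/= leey integral_ge0// => x _; exact: poweR_ge0.
  apply: ge0_le_nonmeasurable_integral => x; first exact: poweR_ge0.
  apply: gt0_ler_poweR; rewrite ?(ltW p0)//; last by rewrite lee_fin.
  + by rewrite in_itv/= leey andbT lee_fin.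
  + by rewrite in_itv/= leey andbT lee_fin.
- move=> _; case: ifPn => // _; apply: le_ess_sup; apply: nearW => x /=.
  by rewrite lee_fin.
Qed.

Lemma mem_fspace_cst0 : mem_fspace X (fun=> 0).
Proof.
case: X => [p p1||] /=.
- rewrite (_ : _ \_ _ = cst 0); last by apply/funext => x; rewrite patchE;
  case: ifP.
  apply/andP; split; rewrite inE//=.
  exact: (finite_norm_cst0 _ p1).
- by apply: continuous_subspaceT => x; exact: cvg_cst.
- by split=> x _; [exact: cvg_cst|apply/cvg_ex; exists 0; exact: cvg_cst].
Qed.

Lemma fnorm_cst0 : fnorm X (fun=> 0) = 0%E.
Proof.
apply/eqP; rewrite eq_le fnorm_ge0 andbT.
case: X => [p p1||] /=; last 2 first.
- by apply: ge_ereal_sup => _ [x _ <-]; rewrite normr0.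
- by apply: ge_ereal_sup => _ [x _ <-]; rewrite normr0.
rewrite (_ : EFin \o _ = cst 0%E).
  by rewrite Lnorm0// gt_eqF// (lt_le_trans _ p1).
by apply/funext => x /=; rewrite patchE; case: ifP.
Qed.

Lemma mem_fspace_lin a b f g : mem_fspace X f -> mem_fspace X g ->
  mem_fspace X (fun x => a * f x + b * g x).
Proof.
case: X => [p p1||] /=.
- move=> fX gX.
  have [L0 L] := Lfun_submod_closed (@lebesgue_measure R) p1.
  have -> : (fun x => a * f x + b * g x) \_ `[0, 1] =
      a *: (f \_ `[0, 1]) + (b *: (g \_ `[0, 1]) + 0) :> (R -> R).
    apply/funext => x.
    rewrite -[RHS]/(a * (f \_ `[0, 1]) x + (b * (g \_ `[0, 1]) x + 0)) !patchE.
    by case: ifPn => _; rewrite ?mulr0 !addr0.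
  exact: L a _ _ fX (L b _ _ gX L0).
- move=> fX gX x.
  by apply: cvgD; apply: cvgM; [exact: cvg_cst|exact: fX|exact: cvg_cst|exact: gX].
- move=> [fr fl] [gr gl]; split=> x x01.
    by apply: cvgD; apply: cvgM;
      [exact: cvg_cst|exact: fr|exact: cvg_cst|exact: gr].
  have /cvg_ex[lf hf] := fl x x01; have /cvg_ex[lg hg] := gl x x01.
  apply/cvg_ex; exists (a * lf + b * lg).
  by apply: cvgD; apply: cvgM => //; exact: cvg_cst.
Qed.

Lemma mem_fspace_norm f : mem_fspace X f -> mem_fspace X (fun x => `|f x|).
Proof.
have := le_fnorm (fun x => `|f x|) f.
case: X => [p p1||] /=.
- move=> H /andP[mf ff]; apply/andP; split.
    rewrite !inE /= in mf *.
    rewrite (_ : _ \_ _ = Num.norm \o (f \_ `[0, 1]));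
      first exact: measurableT_comp.
    by apply/funext => x /=; rewrite !patchE; case: ifP => //; rewrite normr0.
  rewrite inE/= in ff; rewrite inE/=.
  apply: le_lt_trans ff; apply: H => x _; by rewrite normr_id.
- move=> _ fX x; apply: cvg_norm; exact: fX.
- move=> _ [fr fl]; split=> x x01; first by apply: cvg_norm; exact: fr.
  have /cvg_ex[lf hf] := fl x x01; apply/cvg_ex; exists `|lf|; exact: cvg_norm.
Qed.

Lemma fnormD f g : mem_fspace X f -> mem_fspace X g ->
  (fnorm X (f \+ g)%R <= fnorm X f + fnorm X g)%E.
Proof.
have tri : (ereal_sup [set `|f x + g x|%:E | x in `[0%R, 1%R]] <=
    ereal_sup [set `|f x|%:E | x in `[0%R, 1%R]] +
    ereal_sup [set `|g x|%:E | x in `[0%R, 1%R]])%E.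
  apply: ge_ereal_sup => _ [x x01 <-].
  rewrite (@le_trans _ _ (`|f x|%:E + `|g x|%:E)%E)//.
    by rewrite -EFinD lee_fin ler_normD.
  by apply: leeD; apply: ereal_sup_ubound; exists x.
case: X => [p p1||] //=.
move=> /andP[mf ff] /andP[mg fg].
rewrite !inE /= in mf mg.
have := eminkowski lebesgue_measure mf mg p1; apply: le_trans.
rewrite le_eqVlt; apply/orP; left; apply/eqP; congr Lnorm.
apply/funext => x /=; rewrite !patchE; case: ifP => //= _; by rewrite addr0.
Qed.

(** For continuous and for cadlag functions, boundedness near each point of
    [0, 1] upgrades to boundedness on [0, 1] by compactness. *)
Lemma fnorm_fin f : mem_fspace X f -> (fnorm X f < +oo)%E.
Proof.
have bnd : (forall x : R, x \in `[0, 1] ->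
      exists M : R, \forall y \near x, y \in `[0, 1] -> `|f y| <= M) ->
    (ereal_sup [set `|f x|%:E | x in `[0%R, 1%R]] < +oo)%E.
  move=> H.
  have /compact_near_coveringP K := @segment_compact R 0 1.
  have /filter_ex[M Mf] : \forall M \near +oo,
      `[0, 1] `<=` (fun y => y \in `[0, 1] -> `|f y| <= M).
    apply: K => x x01; have [M hM] := H x x01.
    near=> y N => /= y01; apply: (@le_trans _ _ M).
      by move: y01; near: y; exact: hM.
    by near: N; exact/nbhs_pinfty_ge/num_real.
  apply: (@le_lt_trans _ _ M%:E); last exact: ltry.
  by apply: ge_ereal_sup => _ [x x01 <-]; rewrite lee_fin; exact: Mf.
case: X => [p p1||] /=.
- by move=> /andP[_]; rewrite inE.
- move=> fX; apply: bnd => x x01; exists (`|f x| + 1).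
  have /subspace_continuousP/(_ x x01)/cvgrPdist_le/(_ 1 ltr01) := fX.
  apply: filterS => y; rewrite -lerBlDl; apply: le_trans.
  by rewrite distrC; exact: lerB_dist.
- move=> [fr fl]; apply: bnd => x x01.
  (* beyond an end point of [0, 1] there is nothing to bound *)
  have [Mr hr] : exists M, \forall y \near x^'+, y \in `[0, 1] -> `|f y| <= M.
    have [x1|x1] := ltP x 1.
      have x01' : x \in `[0, 1[ by move: x01; rewrite !in_itv/= x1 => /andP[-> _].
      have /cvgrPdist_le/(_ 1 ltr01) := fr x x01'.
      exists (`|f x| + 1); near=> y => _; rewrite -lerBlDl.
      apply: (@le_trans _ _ `|f x - f y|); last by near: y.
      by rewrite distrC; exact: lerB_dist.
    exists 0; near=> y => /itvP y01; suff : y <= x by rewrite leNgt (_ : x < y).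
    by rewrite (le_trans _ x1)// y01.
  have [Ml hl] : exists M, \forall y \near x^'-, y \in `[0, 1] -> `|f y| <= M.
    have [x0|x0] := ltP 0 x.
      have x01' : x \in `]0, 1] by move: x01; rewrite !in_itv/= x0 => /andP[_ ->].
      have /cvg_ex[l /cvgrPdist_le/(_ 1 ltr01)] := fl x x01'.
      exists (`|l| + 1); near=> y => _; rewrite -lerBlDl.
      apply: (@le_trans _ _ `|l - f y|); last by near: y.
      by rewrite distrC; exact: lerB_dist.
    exists 0; near=> y => /itvP y01; suff : x <= y by rewrite leNgt (_ : y < x).
    by rewrite (le_trans x0)// y01.
  exists (Num.max `|f x| (Num.max Mr Ml)).
  rewrite /at_left /at_right in hr hl.
  near=> y => y01; rewrite !le_max.
  have [yx|xy|->] := ltgtP y x; last by rewrite lexx.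
    apply/orP; right; apply/orP; right; move: y01; move: yx; near: y; exact: hl.
  apply/orP; right; apply/orP; left; move: y01; move: xy; near: y; exact: hr.
Unshelve. all: by end_near. Qed.

Lemma mem_fspaceB f g : mem_fspace X f -> mem_fspace X g -> mem_fspace X (f \- g).
Proof.
move=> fX gX; have := mem_fspace_lin 1 (-1) f g fX gX; congr mem_fspace.
by apply/funext => x; rewrite mul1r mulN1r.
Qed.

(** The dominated function need not belong to the space: it is compared with the
    sum of the absolute values, to which the triangle inequality applies. *)
Lemma fnorm_le_sum (I : Type) (r : seq I) f (g : I -> R -> R) :
  (forall i, mem_fspace X (g i)) ->
  (forall x, x \in `[0, 1] -> `|f x| <= \sum_(i <- r) `|g i x|) ->
  (fnorm X f <= \sum_(i <- r) fnorm X (g i))%E.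
Proof.
move=> gX fg.
pose s r x : R := \sum_(i <- r) `|g i x|.
have : mem_fspace X (s r) /\ (fnorm X (s r) <= \sum_(i <- r) fnorm X (g i))%E.
  elim: {fg} r => [|i r [IHm IHn]].
    rewrite (_ : s [::] = fun=> 0); last by apply/funext => x; rewrite /s big_nil.
    split; first exact: mem_fspace_cst0.
    by rewrite big_nil fnorm_cst0.
  have sE : s (i :: r) = (fun x => `|g i x|) \+ s r.
    by apply/funext => x; rewrite /s big_cons.
  have gn := mem_fspace_norm _ (gX i).
  rewrite sE; split.
    have := mem_fspace_lin 1 1 _ _ gn IHm; congr mem_fspace.
    by apply/funext => x; rewrite !mul1r.
  apply: (le_trans (fnormD _ _ gn IHm)); rewrite big_cons leeD//.
  by apply: le_fnorm => x _; rewrite normr_id.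
move=> [_]; apply: le_trans; apply: le_fnorm => x /fg fx.
by rewrite (le_trans fx)// ler_norm.
Qed.

Lemma fdist_ge0 f g : (0 <= fdist X f g)%E. Proof. exact: fnorm_ge0. Qed.

Lemma fdist_fin f g : mem_fspace X f -> mem_fspace X g -> (fdist X f g < +oo)%E.
Proof. by move=> fX gX; apply: fnorm_fin; exact: mem_fspaceB. Qed.

Lemma fdistC f g : fdist X f g = fdist X g f.
Proof.
by apply/eqP; rewrite eq_le !le_fnorm// => x _ /=; rewrite distrC.
Qed.

Lemma fdist_triangle f g h : mem_fspace X f -> mem_fspace X g ->
  mem_fspace X h -> (fdist X f h <= fdist X f g + fdist X g h)%E.
Proof.
move=> fX gX hX.
have := fnormD _ _ (mem_fspaceB _ _ fX gX) (mem_fspaceB _ _ gX hX).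
by apply: le_trans; apply: le_fnorm => x _ /=; rewrite addrA subrK.
Qed.

Lemma fdist_eq_on f g : (forall x, x \in `[0, 1] -> f x = g x) ->
  fdist X f g = 0%E.
Proof.
move=> fg; apply/eqP; rewrite eq_le fdist_ge0 andbT -fnorm_cst0.
by apply: le_fnorm => x x01 /=; rewrite fg// subrr.
Qed.

(** The constant is the integer following the absolute value of a, because a
    multiple by a natural number can be bounded by repeated use of the triangle
    inequality. *)
Lemma fdist_scale (a : R) f g h : mem_fspace X f -> mem_fspace X g ->
  (fdist X (fun x => a * (f x - h x))%R (fun x => a * (g x - h x))%R <=
   (Num.truncn `|a|).+1%:R%:E * fdist X f g)%E.
Proof.
move=> fX gX.
have := @fnorm_le_sum 'I_((Num.truncn `|a|).+1) (index_enum _)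
   (fun x => a * (f x - h x) - a * (g x - h x)) (fun=> f \- g)
   (fun=> mem_fspaceB _ _ fX gX).
have -> : (\sum_(i < (Num.truncn `|a|).+1) fnorm X (f \- g)%R =
    (Num.truncn `|a|).+1%:R%:E * fdist X f g)%E.
  have dfin : fnorm X (f \- g) \is a fin_num.
    by rewrite ge0_fin_numE ?fnorm_ge0//; exact: fdist_fin.
  by rewrite /fdist -(fineK dfin) sumEFin sumr_const card_ord -EFinM mulr_natl.
apply => x x01; rewrite sumr_const card_ord -mulrBr opprB addrA subrK normrM.
rewrite -mulr_natl ler_wpM2r//; exact/ltW/truncnS_gt.
Qed.

End function_spaces.

Section pointwise_quantile.
Context {R : realType} (X : fspace R) (k : nat) (k0 : (0 < k)%N).
Variables (alpha : R -> R) (halpha : forall x, x \in `[0, 1] -> 0 < alpha x < 1).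

Lemma fdist_pquantile (f g : 'I_k -> R -> R) :
  (forall i, mem_fspace X (f i)) -> (forall i, mem_fspace X (g i)) ->
  (fdist X (pquantile alpha f) (pquantile alpha g) <=
   \sum_i fdist X (f i) (g i))%E.
Proof.
move=> fX gX; apply: fnorm_le_sum => [i|x x01]; first exact: mem_fspaceB.
exact: quantile_lipschitz (halpha x x01).
Qed.

Lemma fdist_pquantile_cst (f : 'I_k -> R -> R) (theta : R -> R) :
  (forall i, mem_fspace X (f i)) -> mem_fspace X theta ->
  (fdist X (pquantile alpha f) theta <= \sum_i fdist X (f i) theta)%E.
Proof.
move=> fX thetaX; apply: fnorm_le_sum => [i|x x01]; first exact: mem_fspaceB.
have thetaE : theta x = quantile (alpha x) (fun _ : 'I_k => theta x).
  by rewrite quantile_cst// halpha.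
rewrite /= {1}thetaE.
exact: quantile_lipschitz (halpha x x01).
Qed.

(** Outside [0, 1] the levels are unconstrained and the two functions may
    differ; the distance does not see this. *)
Lemma fdist_pquantile_affine (a : R) (f : 'I_k -> R -> R) (theta : R -> R) :
  0 <= a ->
  fdist X (fun x => a * (pquantile alpha f x - theta x))
    (pquantile alpha (fun i x => a * (f i x - theta x))) = 0%E.
Proof.
move=> a0; apply: fdist_eq_on => x x01; rewrite /pquantile.
have := quantile_affine (alpha x) (fun i => f i x) a (- a * theta x) k0
  (halpha x x01) a0.
rewrite mulrBr mulNr => <-; congr quantile; apply/funext => i.
by rewrite mulrBr.
Qed.

End pointwise_quantile.

(** * Means of bounded random variables and independence *)

Definition bounded_measurable (R : realType) (d : measure_display)
    (T : measurableType d) (f : T -> R) : Prop :=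
  measurable_fun setT f /\ exists M : R, forall w, `|f w| <= M.

Section bounded_measurable.
Context {R : realType} {d : measure_display} {T : measurableType d}.
Implicit Types f g h : T -> R.
Local Notation bmf := (@bounded_measurable R d T).

Lemma bounded_measurable_cst (c : R) : bmf (fun=> c).
Proof. by split; [exact: measurable_cst|exists `|c|]. Qed.

Lemma bounded_measurableD f g : bmf f -> bmf g -> bmf (fun w => f w + g w).
Proof.
move=> [mf [M fM]] [mg [N gN]]; split; first exact: measurable_funD.
by exists (M + N) => w; rewrite (le_trans (ler_normD _ _))// lerD.
Qed.

Lemma bounded_measurableM f g : bmf f -> bmf g -> bmf (fun w => f w * g w).
Proof.
move=> [mf [M fM]] [mg [N gN]]; split; first exact: measurable_funM.
by exists (M * N) => w; rewrite normrM ler_pM.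
Qed.

Lemma bounded_measurableB f g : bmf f -> bmf g -> bmf (fun w => f w - g w).
Proof.
move=> bf bg; have bNg := bounded_measurableM _ _ (bounded_measurable_cst (-1)) bg.
have := bounded_measurableD _ _ bf bNg.
by congr (bounded_measurable _ _ _ _); apply/funext => w; rewrite mulN1r.
Qed.

Lemma bounded_measurable_norm f : bmf f -> bmf (fun w => `|f w|).
Proof.
move=> [mf [M fM]]; split; first exact: measurableT_comp.
by exists M => w; rewrite normr_id.
Qed.

Lemma bounded_measurable_sum (I : Type) (r : seq I) (p : pred I) (f : I -> T -> R) :
  (forall i, bmf (f i)) -> bmf (fun w => \sum_(i <- r | p i) f i w).
Proof.
move=> bf; elim: r => [|i r IH].
  by under eq_fun do rewrite big_nil; exact: bounded_measurable_cst.
by under eq_fun do rewrite big_cons; case: (p i) => //; exact: bounded_measurableD.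
Qed.

Lemma bounded_measurable_prod (I : Type) (r : seq I) (p : pred I)
    (f : I -> T -> R) :
  (forall i, bmf (f i)) -> bmf (fun w => \prod_(i <- r | p i) f i w).
Proof.
move=> bf; elim: r => [|i r IH].
  by under eq_fun do rewrite big_nil; exact: bounded_measurable_cst.
by under eq_fun do rewrite big_cons; case: (p i) => //; exact: bounded_measurableM.
Qed.

Lemma bounded_measurable_indic (A : set T) : measurable A -> bmf (\1_A).
Proof.
move=> mA; split; first exact: measurable_indic.
by exists 1 => w; rewrite indicE; case: (_ \in _); rewrite ?normr1 ?normr0.
Qed.

Variable P : probability T R.
Local Notation E f := (Rintegral P setT f).

Lemma bounded_measurable_integrable f : bmf f -> P.-integrable setT (EFin \o f).
Proof.
move=> [mf [M fM]]; apply: measurable_bounded_integrable => //.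
  by rewrite (le_lt_trans (probability_le1 _ _))// ltry.
exists M; split; first exact: num_real.
by move=> N MN w _; exact: le_trans (fM w) (ltW MN).
Qed.

Lemma mean_cst (c : R) : E (fun=> c) = c.
Proof.
rewrite (Rintegral_cst P measurableT) [X in _ * fine X]probability_setT.
by rewrite mulr1.
Qed.

Lemma meanD f g : bmf f -> bmf g -> E (fun w => f w + g w) = E f + E g.
Proof.
by move=> bf bg; rewrite RintegralD//; exact: bounded_measurable_integrable.
Qed.

Lemma meanB f g : bmf f -> bmf g -> E (fun w => f w - g w) = E f - E g.
Proof.
by move=> bf bg; rewrite RintegralB//; exact: bounded_measurable_integrable.
Qed.

Lemma meanZ f (c : R) : bmf f -> E (fun w => c * f w) = c * E f.
Proof.
by move=> bf; rewrite RintegralZl//; exact: bounded_measurable_integrable.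
Qed.

Lemma le_mean f g : bmf f -> bmf g -> (forall w, f w <= g w) -> E f <= E g.
Proof.
by move=> bf bg fg; apply: le_Rintegral => //; exact: bounded_measurable_integrable.
Qed.

Lemma mean_sum (I : Type) (r : seq I) (f : I -> T -> R) :
  (forall i, bmf (f i)) ->
  E (fun w => \sum_(i <- r) f i w) = \sum_(i <- r) E (f i).
Proof.
move=> bf; elim: r => [|i r IH].
  by under eq_Rintegral do rewrite big_nil; rewrite mean_cst big_nil.
under eq_Rintegral do rewrite big_cons.
by rewrite meanD// ?big_cons ?IH//; exact: bounded_measurable_sum.
Qed.

Lemma mean_indic (A : set T) : measurable A -> E (\1_A) = fine (P A).
Proof. by move=> mA; rewrite /Rintegral integral_indic// setIT. Qed.

Lemma mean_close f g (e : R) : bmf f -> bmf g -> (forall w, `|f w - g w| <= e) ->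
  `|E f - E g| <= e.
Proof.
move=> bf bg fge; rewrite -meanB//; have bfg := bounded_measurableB _ _ bf bg.
rewrite (le_trans (le_normr_Rintegral _ (bounded_measurable_integrable _ bfg)))//.
rewrite -[leRHS]mean_cst; apply: le_mean => //;
  first exact: bounded_measurable_norm.
exact: bounded_measurable_cst.
Qed.

(** Round f down to a grid of mesh e that starts at the lower bound - M. *)
Lemma bounded_measurable_approx f (e : R) : bmf f -> 0 < e ->
  exists (n : nat) (c : 'I_n -> R) (B : 'I_n -> set R),
    (forall j, measurable (B j)) /\
    forall w, `|f w - \sum_(j < n) c j * \1_(f @^-1` B j) w| <= e.
Proof.
move=> [mf [M fM]] e0.
pose c (j : nat) : R := - M + j%:R * e.
pose n := (Num.truncn (2 * M / e)).+1.
exists n, (fun j => c j), (fun j => `[c j, c j.+1[%classic); split=> [j|w].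
  exact: measurable_itv.
have /andP[fl fu] : - M <= f w <= M by rewrite -ler_norml.
pose j0 := Num.truncn ((f w + M) / e).
have q0 : 0 <= (f w + M) / e by rewrite divr_ge0 ?(ltW e0)//; lra.
have /andP[j1 j2] : j0%:R <= (f w + M) / e < j0.+1%:R by exact: truncn_itv.
have j0n : (j0 < n)%N.
  rewrite ltnS /j0; apply: le_truncn; rewrite ler_pM2r ?invr_gt0//; lra.
have fj0 : c j0 <= f w < c j0.+1.
  move: j1 j2; rewrite ler_pdivlMr// ltr_pdivrMr// /c; lra.
rewrite (bigD1 (Ordinal j0n))//= big1 => [|j jj0].
  rewrite addr0 indicE mem_set ?mulr1; last by rewrite /= in_itv.
  move: fj0; rewrite /c -natr1 mulrDl mul1r => /andP[u1 u2].
  by rewrite ler_norml; apply/andP; split; lra.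
rewrite indicE memNset ?mulr0// /= in_itv /= => /andP[v1 v2].
suff jE : j = j0 :> nat by move/eqP: jj0; apply; exact/val_inj.
apply/esym/truncn_def => //; rewrite ler_pdivlMr// ltr_pdivrMr//.
by move: v1 v2; rewrite /c => v1 v2; apply/andP; split; lra.
Qed.

End bounded_measurable.

Section equality_in_law.
Context {R : realType} {d d' : measure_display}.
Context {T : measurableType d} {T' : measurableType d'}.

Lemma mean_eq_law (P : probability T R) (P' : probability T' R)
    (f : T -> R) (g : T' -> R) :
  bounded_measurable R d T f -> bounded_measurable R d' T' g ->
  (forall B, measurable B -> P (f @^-1` B) = P' (g @^-1` B)) ->
  \int[P]_w f w = \int[P']_w g w.
Proof.
move=> [mf [M fM]] [mg [N gN]] fg; congr fine.
have bf : bounded_measurable R d T f by split=> //; exists M.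
have bg : bounded_measurable R d' T' g by split=> //; exists N.
pose X : {mfun T >-> R} := mfun_Sub (mem_set mf).
pose X' : {mfun T' >-> R} := mfun_Sub (mem_set mg).
have -> : (\int[P]_w (f w)%:E = \int[distribution P X]_x x%:E)%E.
  by rewrite integral_distribution//=; exact: bounded_measurable_integrable.
have -> : (\int[P']_w (g w)%:E = \int[distribution P' X']_x x%:E)%E.
  by rewrite integral_distribution//=; exact: bounded_measurable_integrable.
apply: eq_measure_integral => A mA _.
exact: fg.
Qed.

End equality_in_law.

Section independence.
Context {R : realType} {d : measure_display} {T : measurableType d}.
Variable P : probability T R.
Local Notation bmf := (bounded_measurable R d T).
Local Notation E f := (Rintegral P setT f).

(** For the pi-lambda theorem.  Increasing unions are handled by dominated
    convergence, the bound of h being integrable. *)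
Lemma mean_indic_lambda_system (h : T -> R) : bmf h ->
  lambda_system setT [set A | measurable A /\
    E (fun w => h w * \1_A w) = E h * fine (P A)].
Proof.
move=> bh; split=> //.
- split; first exact: measurableT.
  rewrite [X in _ * fine X]probability_setT mulr1; apply: eq_Rintegral => w _.
  by rewrite indicT mulr1.
- move=> A B BA [mA hA] [mB hB]; split; first exact: measurableD.
  have -> : E (fun w => h w * \1_(A `\` B) w) =
      E (fun w => h w * \1_A w - h w * \1_B w).
    apply: eq_Rintegral => w _; rewrite -mulrBr; congr (_ * _).
    rewrite !indicE in_setD; case: (boolP (w \in B)) => wB /=.
      by rewrite (mem_set (BA _ (set_mem wB))) subrr.
    by rewrite andbT subr0.
  rewrite meanB; [|exact: bounded_measurableM (bounded_measurable_indic _ _)..].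
  rewrite hA hB -mulrBr measureD//; last first.
    by rewrite (le_lt_trans (probability_le1 _ _))// ltry.
  by rewrite fineB ?fin_num_measure// setIidr.
- move=> F ndF hF; have mF n : measurable (F n) by have [] := hF n.
  have mU : measurable (\bigcup_n F n) by exact: bigcup_measurable.
  split=> //.
  have bF n := bounded_measurableM _ _ bh (bounded_measurable_indic _ (mF n)).
  have bU := bounded_measurableM _ _ bh (bounded_measurable_indic _ mU).
  have [M hM] := bh.2.
  have cvgE : E (fun w => h w * \1_(F n) w) @[n --> \oo] -->
      E (fun w => h w * \1_(\bigcup_n F n) w).
    apply: fine_cvg; rewrite fineK;
      last exact/integrable_fin_num/bounded_measurable_integrable.
    have [] // := @dominated_convergence _ T R P setT measurableT
      (fun n w => (h w * \1_(F n) w)%:E) (fun w => (h w * \1_(\bigcup_n F n) w)%:E)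
      (fun=> M%:E)
      (fun n => measurable_int _ (bounded_measurable_integrable P _ (bF n)))
      (measurable_int _ (bounded_measurable_integrable P _ bU))
      _ (bounded_measurable_integrable P _ (bounded_measurable_cst M)) _.
    - apply: aeW => w _; apply: cvg_near_cst.
      have [[N _ FNw]|nFw] := pselect ((\bigcup_n F n) w).
        exists N => // m /= Nm; rewrite !indicE !mem_set//; first by exists N.
        by have /subsetPset/(_ _ FNw) := ndF _ _ Nm.
      exists 0%N => // m _; rewrite !indicE !memNset// => Fmw.
      by apply: nFw; exists m.
    - apply: aeW => w m _ /=; rewrite lee_fin normrM (le_trans _ (hM w))//.
      rewrite ler_piMr// indicE; case: (_ \in _); rewrite ?normr1 ?normr0//.
  have cvgP : E h * fine (P (F n)) @[n --> \oo] --> E h * fine (P (\bigcup_n F n)).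
    apply: cvgM; first exact: cvg_cst.
    apply: fine_cvg; rewrite fineK ?fin_num_measure//.
    exact: nondecreasing_cvg_mu.
  have cvgP' : E (fun w => h w * \1_(F n) w) @[n --> \oo] -->
      E h * fine (P (\bigcup_n F n)).
    by under eq_fun => n do rewrite (hF n).2.
  exact: (cvg_unique _ cvgE cvgP').
Qed.

(** By the pi-lambda theorem the factorization passes from the
    pi-system to the sigma-algebra that it generates, and from indicators to f by
    approximating f uniformly with finite sums of indicators. *)
Lemma mean_indep (G : set (set T)) (h f : T -> R) :
  G setT -> setI_closed G -> G `<=` measurable -> bmf h -> bmf f ->
  (forall B, measurable B -> <<s G >> (f @^-1` B)) ->
  (forall A, G A -> E (fun w => h w * \1_A w) = E h * fine (P A)) ->
  E (fun w => h w * f w) = E h * E f.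
Proof.
move=> GT GI Gm bh bf fG hG.
have sG : <<s G >> `<=` [set A | measurable A /\
    E (fun w => h w * \1_A w) = E h * fine (P A)].
  apply: lambda_system_subset => //; first exact: mean_indic_lambda_system.
  by move=> A GA; split; [exact: Gm|exact: hG].
have [M hM] := bh.2.
have M0 : 0 <= M by rewrite (le_trans _ (hM point)).
apply/eqP; rewrite -subr_eq0 -normr_le0; apply/ler_addgt0Pl => e e0; rewrite addr0.
(* each of the two means moves by at most M * e' when f is replaced by s *)
pose e' := e / (2 * (M + 1)).
have e'0 : 0 < e' by rewrite divr_gt0// mulr_gt0// ltr_wpDl.
have [n [c [B [mB fB]]]] := bounded_measurable_approx _ _ bf e'0.
pose s w := \sum_(j < n) c j * \1_(f @^-1` B j) w.
have mfB j : measurable (f @^-1` B j) by have [] := sG _ (fG _ (mB j)).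
have bcj j : bmf (fun w => c j * \1_(f @^-1` B j) w).
  by apply: bounded_measurableM;
    [exact: bounded_measurable_cst|exact: bounded_measurable_indic].
have bs : bmf s by exact: bounded_measurable_sum.
have Ehs : E (fun w => h w * s w) = E h * E s.
  rewrite /s mean_sum// mulr_sumr.
  under eq_Rintegral do rewrite mulr_sumr.
  rewrite mean_sum => [|j]; last exact: bounded_measurableM.
  apply: eq_bigr => j _; under eq_Rintegral do rewrite mulrCA.
  rewrite (meanZ P (fun w => h w * \1_(f @^-1` B j) w) (c j)); last first.
    exact: bounded_measurableM (bounded_measurable_indic _ (mfB j)).
  have [_ ->] := sG _ (fG _ (mB j)).
  rewrite (meanZ P (\1_(f @^-1` B j)) (c j)); last exact: bounded_measurable_indic.
  by rewrite mean_indic// mulrCA.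
have h1 : `|E (fun w => h w * f w) - E (fun w => h w * s w)| <= M * e'.
  apply: mean_close; [exact: bounded_measurableM|exact: bounded_measurableM|] => w.
  by rewrite -mulrBr normrM ler_pM.
have h2 : `|E h * E s - E h * E f| <= M * e'.
  rewrite -mulrBr normrM ler_pM//.
    by rewrite -[E h]subr0 -(mean_cst P 0); apply: mean_close => //;
      [exact: bounded_measurable_cst|move=> w; rewrite subr0].
  by rewrite distrC; exact: mean_close.
rewrite -(subrKA (E (fun w => h w * s w))) (le_trans (ler_normD _ _))//.
rewrite [X in _ + `|X - _|]Ehs (le_trans (lerD h1 h2))//.
have : e' * (2 * (M + 1)) = e by rewrite divfK// gt_eqF// mulr_gt0// ltr_wpDl.
by lra.
Qed.

(** The events of the pi-systems are replaced by the random variables one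
    coordinate at a time: for the coordinates in a list r the factor is f i, for
    the others still an indicator, and each step is an instance of [mean_indep]
    with h the product of all the other factors. *)
Lemma mean_prod_indep (I : finType) (G : I -> set (set T)) (f : I -> T -> R) :
  (forall i, [/\ G i setT, setI_closed (G i) & G i `<=` measurable]) ->
  (forall A : I -> set T, (forall i, G i (A i)) ->
     fine (P (\bigcap_i A i)) = \prod_i fine (P (A i))) ->
  (forall i, bmf (f i)) ->
  (forall i B, measurable B -> <<s G i >> (f i @^-1` B)) ->
  E (fun w => \prod_i f i w) = \prod_i E (f i).
Proof.
move=> GP Gprod bf fG.
have Gm i : G i `<=` measurable by case: (GP i).
pose g (r : seq I) (A : I -> set T) i : T -> R := if i \in r then f i else \1_(A i).
have bg r A : (forall i, G i (A i)) -> forall i, bmf (g r A i).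
  by move=> GA i; rewrite /g; case: ifP => // _;
    apply/bounded_measurable_indic/(Gm i).
suff H r A : uniq r -> (forall i, G i (A i)) ->
    E (fun w => \prod_i g r A i w) = \prod_i E (g r A i).
  have GT i : G i setT by have [] := GP i.
  have := H (enum I) (fun=> setT) (enum_uniq I) GT.
  have gE i : g (enum I) (fun=> setT) i = f i by rewrite /g mem_enum.
  under eq_Rintegral do under eq_bigr do rewrite gE.
  by move=> ->; apply: eq_bigr => i _; rewrite gE.
elim: r A => [|i r IH] A.
  move=> _ GA; rewrite /g /=.
  have mA i : measurable (A i) := Gm i _ (GA i).
  transitivity (fine (P (\bigcap_i A i))).
    rewrite -mean_indic; last by apply: fin_bigcap_measurable => //;
      exact: finite_finset.
    apply: eq_Rintegral => w _ /=.
    have [wA|wA] := boolP (w \in \bigcap_i A i).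
      rewrite big1// => i _; rewrite indicE mem_set//.
      by move: wA; rewrite inE => /(_ i); apply.
    have [i wAi] : exists i, ~ A i w.
      apply/existsNP => h; move/negP: wA; apply; rewrite inE => i _; exact: h.
    by rewrite (bigD1 i)//= indicE memNset// mul0r.
  by rewrite Gprod//; apply: eq_bigr => i _; rewrite mean_indic.
move=> /= /andP[ir ur] GA.
pose h w := \prod_(j | j != i) g r A j w.
have bh : bmf h by apply: bounded_measurable_prod; exact: bg.
have gir B : g r B i = \1_(B i) by rewrite /g (negbTE ir).
have gi j : j != i -> g (i :: r) A j = g r A j.
  by rewrite /g inE => /negbTE->.
have gii : g (i :: r) A i = f i by rewrite /g inE eqxx.
rewrite (bigD1 i)//= gii.
under eq_Rintegral do rewrite (bigD1 i)//= gii mulrC.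
under eq_Rintegral do under eq_bigr => j ji do rewrite gi//.
under [X in _ = _ * X]eq_bigr => j ji do rewrite gi//.
(* the induction hypothesis, for an arbitrary event B at coordinate i *)
have key B : G i B -> E (fun w => h w * \1_B w) =
    (\prod_(j | j != i) E (g r A j)) * fine (P B).
  move=> GB; pose A' j := if j == i then B else A j.
  have GA' j : G j (A' j) by rewrite /A'; case: eqP => // ->.
  have gA' j : j != i -> g r A' j = g r A j by rewrite /g /A' => /negbTE ->.
  have A'i : A' i = B by rewrite /A' eqxx.
  have := IH A' ur GA'; rewrite (bigD1 i)//= gir A'i mean_indic;
    last exact: Gm i _ GB.
  under [X in _ = _ * X -> _]eq_bigr => j ji do rewrite gA'//.
  rewrite mulrC => <-; apply: eq_Rintegral => w _.
  rewrite (bigD1 i)//= gir A'i mulrC; congr (_ * _).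
  by apply: eq_bigr => j ji; rewrite gA'.
have Eh : E h = \prod_(j | j != i) E (g r A j).
  have [GT _ _] := GP i; have := key _ GT.
  rewrite [X in _ * fine X]probability_setT mulr1 => <-; apply: eq_Rintegral => w _.
  by rewrite indicT mulr1.
have [GT GI _] := GP i.
rewrite mulrC -Eh; apply: (mean_indep (G i)) => //; first exact: fG.
by move=> B GB; rewrite key// Eh.
Qed.

End independence.

(** * Samples and their blocks *)

Section tuple_rectangles.
Context {d : measure_display} {S : measurableType d} (m : nat).

Definition tuple_rectangle : set (set (m.-tuple S)) :=
  [set A | exists B : 'I_m -> set S, (forall j, measurable (B j)) /\
     A = \bigcap_j [set s : m.-tuple S | B j (tnth s j)]].

Lemma measurable_tuple_rectangle : tuple_rectangle `<=` measurable.
Proof.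
move=> A [B [mB ->]]; apply: fin_bigcap_measurable; first exact: finite_finset.
move=> j _; rewrite -[X in measurable X]setTI.
exact: (measurable_tnth j measurableT (mB j)).
Qed.

Lemma setI_tuple_rectangle : setI_closed tuple_rectangle.
Proof.
move=> _ _ [B [mB ->]] [C [mC ->]]; exists (fun j => B j `&` C j).
split; first by move=> j; exact: measurableI.
by rewrite -bigcapI.
Qed.

Lemma tuple_rectangleT : tuple_rectangle setT.
Proof.
exists (fun=> setT); split; first by move=> j; exact: measurableT.
by apply/seteqP; split.
Qed.

(** The product sigma-algebra is defined from cylinders over single coordinates,
    which do not form a pi-system; the rectangles do. *)
Lemma measurable_tupleE :
  @measurable _ (m.-tuple S) = <<s tuple_rectangle >>.
Proof.
apply/seteqP; split; last first.
  apply: smallest_sub; first exact: sigma_algebra_measurable.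
  exact: measurable_tuple_rectangle.
apply: smallest_sub; first exact: smallest_sigma_algebra.
rewrite -bigcup_seq; apply: bigcup_sub => i _ A [B mB <-].
rewrite setTI; apply: sub_sigma_algebra.
exists (fun j => if j == i then B else setT); split.
  by move=> j; case: ifP => // _; exact: measurableT.
apply/seteqP; split=> s /=.
  by move=> Bs j _; case: eqP => [->|].
by move=> /(_ i I); rewrite eqxx.
Qed.

End tuple_rectangles.

Section samples.
Context {R : realType} {dO : measure_display} {Omega : measurableType dO}.
Context {dS : measure_display} {S : measurableType dS}.
Variables (P : probability Omega R) (xi : nat -> Omega -> S).
Hypothesis hxi : iid P measurable xi.

Lemma measurable_obs l : measurable_fun setT (xi l).
Proof. by move=> _ B mB; rewrite setTI; case: hxi => + _ _; exact. Qed.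

Lemma fine_prode (I : Type) (r : seq I) (f : I -> \bar R) :
  (forall i, f i \is a fin_num) ->
  fine (\prod_(i <- r) f i)%E = \prod_(i <- r) fine (f i).
Proof.
move=> ff; elim: r => [|i r IH]; first by rewrite !big_nil.
rewrite !big_cons fineM ?IH//.
by elim: r {IH} => [|j r IH]; rewrite ?big_nil// big_cons fin_numM.
Qed.

(** Independence is assumed for events indexed by the observations; events
    indexed by K are transported along the injection c, with the whole space at
    the observations that c misses. *)
Lemma sample_independent (K : finType) (c : K -> nat) (B : K -> set S) :
  injective c -> (forall p, measurable (B p)) ->
  fine (P (\bigcap_p xi (c p) @^-1` B p)) =
  \prod_p fine (P (xi (c p) @^-1` B p)).
Proof.
move=> cI mB; have [mxi _ ind] := hxi.
pose A l := if [pick p | c p == l] is Some p then B p else setT.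
have Ac p : A (c p) = B p.
  rewrite /A; case: pickP => [q /eqP/cI ->//|/(_ p)].
  by rewrite eqxx.
have mA l : measurable (A l) by rewrite /A; case: pickP.
have := ind (map c (index_enum K)) A; rewrite map_inj_uniq// index_enum_uniq.
move=> /(_ isT mA); rewrite big_map.
have -> : \bigcap_(l in [set` map c (index_enum K)]) xi l @^-1` A l =
    \bigcap_p xi (c p) @^-1` B p.
  apply/seteqP; split=> w /= h.
    by move=> p _; rewrite -Ac; apply: h => /=; apply: map_f;
      rewrite mem_index_enum.
  by move=> _ /= /mapP[p _ ->]; rewrite Ac; exact: h.
move=> ->; rewrite fine_prode => [|p]; last exact/fin_num_measure/mxi.
by apply: eq_bigr => p _; rewrite Ac.
Qed.

Definition sub_sample (m : nat) (c : 'I_m -> nat) (w : Omega) : m.-tuple S :=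
  [tuple xi (c j) w | j < m].

Lemma measurable_sub_sample m (c : 'I_m -> nat) :
  measurable_fun setT (sub_sample m c).
Proof.
apply/measurable_fun_tnthP => j.
rewrite (_ : _ \o _ = xi (c j)); first exact: measurable_obs.
by apply/funext => w /=; rewrite tnth_mktuple.
Qed.

Definition cylinder m (c : 'I_m -> nat) : set (set Omega) :=
  [set A | exists B : 'I_m -> set S, (forall j, measurable (B j)) /\
     A = \bigcap_j xi (c j) @^-1` B j].

Lemma cylinder_pi_system m (c : 'I_m -> nat) :
  [/\ cylinder m c setT, setI_closed (cylinder m c) & cylinder m c `<=` measurable].
Proof.
split.
- exists (fun=> setT); split; first by move=> j; exact: measurableT.
  by apply/seteqP; split.
- move=> _ _ [B [mB ->]] [C [mC ->]]; exists (fun j => B j `&` C j).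
  split; first by move=> j; exact: measurableI.
  by rewrite -bigcapI.
- move=> A [B [mB ->]]; apply: fin_bigcap_measurable; first exact: finite_finset.
  by move=> j _; rewrite -[X in measurable X]setTI; exact: measurable_obs.
Qed.

Lemma preimage_sub_sample m (c : 'I_m -> nat) (A : set (m.-tuple S)) :
  measurable A -> <<s cylinder m c >> (sub_sample m c @^-1` A).
Proof.
rewrite measurable_tupleE; move: A; apply: smallest_sub.
  have [s0 sC sU] := smallest_sigma_algebra setT (cylinder m c).
  split=> [|A hA|F hF] /=.
  - by rewrite preimage_set0.
  - by rewrite setTD preimage_setC -setTD; exact: sC.
  - by rewrite preimage_bigcup; exact: sU.
move=> _ [B [mB ->]] /=; apply: sub_sigma_algebra; exists B; split=> //.
by apply/seteqP; split=> w /= h j _; have := h j; rewrite /= tnth_mktuple; exact.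
Qed.

(** On a rectangle both probabilities are the same product over the coordinates,
    and rectangles form a generating pi-system. *)
Lemma sub_sample_law m (c c' : 'I_m -> nat) (A : set (m.-tuple S)) :
  injective c -> injective c' -> measurable A ->
  P (sub_sample m c @^-1` A) = P (sub_sample m c' @^-1` A).
Proof.
move=> cI c'I mA.
pose X : {mfun Omega >-> m.-tuple S} :=
  mfun_Sub (mem_set (measurable_sub_sample m c)).
pose X' : {mfun Omega >-> m.-tuple S} :=
  mfun_Sub (mem_set (measurable_sub_sample m c')).
rewrite -[LHS]/(distribution P X A) -[RHS]/(distribution P X' A).
refine (@measure_unique _ R (m.-tuple S : measurableType _) (tuple_rectangle m)
  (fun=> setT) _ _ _ _
  (distribution P X) (distribution P X') _ _ A mA) => //.
- exact: measurable_tupleE.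
- exact: setI_tuple_rectangle.
- by move=> i; exact: tuple_rectangleT.
- by rewrite bigcup_const//; exists 0%N.
- move=> _ [B [mB ->]] /=.
  have [mxi same _] := hxi.
  have pE (b : 'I_m -> nat) : injective b ->
      fine (P (sub_sample m b @^-1`
        (\bigcap_j [set s : m.-tuple S | B j (tnth s j)]))) =
      \prod_j fine (P (xi 0%N @^-1` B j)).
    move=> bI; rewrite (_ : _ @^-1` _ = \bigcap_j xi (b j) @^-1` B j).
      by rewrite sample_independent//; apply: eq_bigr => j _; rewrite (same _ 0%N).
    by apply/seteqP; split=> w /= h j _; have := h j; rewrite /= tnth_mktuple;
      exact.
  have mR := measurable_tuple_rectangle m _ (ex_intro _ B (conj mB erefl)).
  rewrite -[LHS]fineK ?fin_num_measure// -[RHS]fineK ?fin_num_measure//.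
  by congr EFin; rewrite [LHS]pE// [RHS]pE.
- by move=> n; rewrite ltey_eq fin_num_measure.
Qed.

Lemma mean_sub_sample m (c c' : 'I_m -> nat) (g : m.-tuple S -> R) :
  injective c -> injective c' -> bounded_measurable R _ _ g ->
  \int[P]_w g (sub_sample m c w) = \int[P]_w g (sub_sample m c' w).
Proof.
move=> cI c'I [mg [M gM]].
have bgs (b : 'I_m -> nat) : bounded_measurable R _ Omega (g \o sub_sample m b).
  split; last by exists M => w; exact: gM.
  exact/(measurableT_comp mg)/measurable_sub_sample.
apply: (mean_eq_law P P (g \o sub_sample m c) (g \o sub_sample m c')) => // B mB.
have mgB : measurable (g @^-1` B) by rewrite -[X in measurable X]setTI; exact: mg.
exact: (sub_sample_law m c c' (g @^-1` B) cI c'I mgB).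
Qed.

(** The blocks are disjoint, so cylinder events over different blocks are
    independent; [mean_prod_indep] extends this to functions of the blocks. *)
Lemma mean_prod_blocks (K : finType) m (c : K -> 'I_m -> nat)
    (g : K -> m.-tuple S -> R) :
  injective (fun p : K * 'I_m => c p.1 p.2) ->
  (forall i, bounded_measurable R _ _ (g i)) ->
  \int[P]_w (\prod_i g i (sub_sample m (c i) w)) =
  \prod_i \int[P]_w g i (sub_sample m (c i) w).
Proof.
move=> cI bg.
have cIi i : injective (c i) by move=> j j' e; have [] := cI (i, j) (i, j') e.
apply: (mean_prod_indep P K (fun i => cylinder m (c i))
    (fun i => g i \o sub_sample m (c i))).
- by move=> i; exact: cylinder_pi_system.
- move=> A hA; have /choice[B hB] : forall i, exists B : 'I_m -> set S,
      (forall j, measurable (B j)) /\ A i = \bigcap_j xi (c i j) @^-1` B j.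
    by move=> i; exact: hA.
  have -> : \bigcap_i A i = \bigcap_p xi (c p.1 p.2) @^-1` B p.1 p.2.
    apply/seteqP; split=> w h.
      move=> [i j] _ /=; have := h i I; rewrite (hB i).2; exact.
    by move=> i _; rewrite (hB i).2 => j _; exact: (h (i, j)).
  rewrite (sample_independent _ (fun p : K * 'I_m => c p.1 p.2)) => //; last first.
    by move=> p; case: (hB p.1).
  transitivity (\prod_i \prod_j fine (P (xi (c i j) @^-1` B i j))).
    by rewrite pair_big.
  apply: eq_bigr => i _; rewrite -sample_independent//; last by case: (hB i).
  by rewrite (hB i).2.
- move=> i; have [mg [M gM]] := bg i; split; last by exists M => w; exact: gM.
  exact/(measurableT_comp mg)/measurable_sub_sample.
- move=> i B mB; rewrite comp_preimage; apply: preimage_sub_sample.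
  by rewrite -[X in measurable X]setTI; exact: (bg i).1.
Qed.

End samples.

(** * Bounded continuous functions and Borel sets *)

Section real_distance.
Context {R : realType} (X : fspace R).
Implicit Types (f g c : R -> R).

(** The distance is finite between members of the space ([fdistE]), and real
    arithmetic is available for this version of it. *)
Definition rdist f g : R := fine (fdist X f g).

Lemma fdistE f g : mem_fspace X f -> mem_fspace X g -> fdist X f g = (rdist f g)%:E.
Proof.
by move=> fX gX; rewrite /rdist fineK// ge0_fin_numE ?fdist_ge0 ?fdist_fin.
Qed.

Lemma rdistC f g : rdist f g = rdist g f.
Proof. by rewrite /rdist fdistC. Qed.

Lemma rdist_triangle f g c : mem_fspace X f -> mem_fspace X g ->
  mem_fspace X c -> rdist f c <= rdist f g + rdist g c.
Proof.
by move=> fX gX cX; rewrite -lee_fin EFinD -!fdistE//; exact: fdist_triangle.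
Qed.

Lemma rdist_lipschitz f g c : mem_fspace X f -> mem_fspace X g ->
  mem_fspace X c -> `|rdist f c - rdist g c| <= rdist f g.
Proof.
move=> fX gX cX; have := rdist_triangle f g c fX gX cX.
have := rdist_triangle g f c gX fX cX; rewrite (rdistC g f) => h1 h2.
by rewrite ler_norml; apply/andP; split; lra.
Qed.

(** A bounded continuous function does not separate functions at distance zero,
    such as functions that differ only outside [0, 1]. *)
Lemma bounded_continuous_eq (h : (R -> R) -> R) f g : bounded_continuous X h ->
  mem_fspace X f -> mem_fspace X g -> fdist X f g = 0%E -> h f = h g.
Proof.
move=> [_ hc] fX gX fg; apply/eqP; rewrite -subr_eq0 -normr_le0.
apply/ler_addgt0Pl => e e0; rewrite addr0; have [r r0 hr] := hc g gX e e0.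
by apply/ltW/hr => //; rewrite fg lte_fin.
Qed.

Lemma bounded_continuous_cst (c : R) : bounded_continuous X (fun=> c).
Proof.
split; first by exists `|c|.
by move=> f fX e e0; exists 1 => // g gX _; rewrite subrr normr0.
Qed.

(** Equal to 1 on the ball of radius r around c, to 0 outside the ball of radius
    2 r, and Lipschitz. *)
Definition bump c (r : R) f : R := Num.max 0 (Num.min 1 (2 - rdist f c / r)).

Lemma bump_itv c r f : 0 <= bump c r f <= 1.
Proof. by rewrite /bump le_max lexx /= ge_max ler01 ge_min lexx. Qed.

Lemma bump1 c r f : 0 < r -> rdist f c <= r -> bump c r f = 1.
Proof.
move=> r0 fr; have : rdist f c / r <= 1 by rewrite ler_pdivrMr// mul1r.
move=> h; rewrite /bump min_l; last lra.
by rewrite max_r.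
Qed.

Lemma bump_neq0 c r f : 0 < r -> bump c r f != 0 -> rdist f c < 2 * r.
Proof.
move=> r0; apply: contraNT; rewrite -leNgt => fr.
have h : 2 <= rdist f c / r by rewrite ler_pdivlMr.
by rewrite /bump min_r ?max_l//; lra.
Qed.

Lemma bump_lipschitz c r f g : 0 < r -> mem_fspace X c ->
  mem_fspace X f -> mem_fspace X g ->
  `|bump c r f - bump c r g| <= rdist f g / r.
Proof.
move=> r0 cX fX gX.
have : `|rdist f c / r - rdist g c / r| <= rdist f g / r.
  rewrite -mulrBl normrM [`|r^-1|]gtr0_norm ?invr_gt0// ler_pM2r ?invr_gt0//.
  exact: rdist_lipschitz.
rewrite /bump; move: (rdist f c / r) (rdist g c / r) (rdist f g / r) => u v s.
rewrite !ler_norml => /andP[h1 h2].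
by rewrite /Num.max /Num.min; do !case: ifPn; rewrite -?leNgt => *;
  apply/andP; split; lra.
Qed.

Lemma bounded_continuous_bump c r : 0 < r -> mem_fspace X c ->
  bounded_continuous X (bump c r).
Proof.
move=> r0 cX; split.
  exists 1 => f _; have /andP[b0 b1] := bump_itv c r f.
  by rewrite ger0_norm.
move=> f fX e e0; exists (e * r); first exact: mulr_gt0.
move=> g gX; rewrite fdistE// lte_fin => gf.
rewrite (le_lt_trans (bump_lipschitz _ _ _ _ r0 cX gX fX))//.
by rewrite ltr_pdivrMr.
Qed.

Lemma bounded_continuous_affine (h : (R -> R) -> R) (a : R) theta :
  mem_fspace X theta -> bounded_continuous X h ->
  bounded_continuous X (fun f => h (fun x => a * (f x - theta x))).
Proof.
move=> thX [[M hM] hc].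
have affX f : mem_fspace X f -> mem_fspace X (fun x => a * (f x - theta x)).
  move=> fX; have := mem_fspace_lin X a (- a) f theta fX thX.
  by congr mem_fspace; apply/funext => x; rewrite mulrBr mulNr.
split; first by exists M => f /affX; exact: hM.
move=> f fX e e0; have [r r0 hr] := hc _ (affX f fX) e e0.
pose L : R := (Num.truncn `|a|).+1%:R; have L0 : 0 < L by rewrite ltr0n.
exists (r / L); first exact: divr_gt0.
move=> g gX; rewrite fdistE// lte_fin ltr_pdivlMr// => gf.
apply: hr; first exact: affX.
apply: (le_lt_trans (fdist_scale _ _ _ _ _ gX fX)).
by rewrite fdistE// -EFinM lte_fin mulrC.
Qed.

End real_distance.

Section borel.
Context {R : realType} (X : fspace R).

Lemma borel_fspace_open (U : set (R -> R)) : open_fspace X U -> borel_fspace X U.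
Proof. by move=> oU; exact: sub_sigma_algebra. Qed.

Lemma borel_fspace_mem : borel_fspace X (mem_fspace X).
Proof. by apply: borel_fspace_open; split=> // f fX; exists 1. Qed.

Lemma borel_fspace_sub U : borel_fspace X U -> U `<=` mem_fspace X.
Proof.
move: U; apply: smallest_sub => //; last by move=> U [].
split=> [|A AX|F FX]; [exact: sub0set|exact: subDsetl|].
by apply: bigcup_sub => i _; exact: FX.
Qed.

(** The whole type of functions is not a Borel set, so complements are taken
    inside the space. *)
Lemma setI_borel_fspace : setI_closed (borel_fspace X).
Proof.
have [s0 sC sU] := smallest_sigma_algebra (mem_fspace X) (open_fspace X).
move=> A B bA bB.
have AX := borel_fspace_sub _ bA; have BX := borel_fspace_sub _ bB.
have -> : A `&` B = mem_fspace X `\`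
    \bigcup_i (bigcup2 (mem_fspace X `\` A) (mem_fspace X `\` B)) i.
  rewrite bigcup2E; apply/seteqP; split=> f.
    by move=> [Af Bf]; split; [exact: AX|move=> [[_ +]|[_ +]]].
  move=> [fX nf]; split; apply: contrapT => h; apply: nf; [left|right]; split=> //.
refine (sC _ (sU _ _)) => -[|[|n]] /=; [exact: sC|exact: sC|exact: s0].
Qed.

(** It is enough to test open rays, whose preimages are open. *)
Lemma borel_fspace_preimage (h : (R -> R) -> R) (B : set R) :
  bounded_continuous X h -> measurable B ->
  borel_fspace X (mem_fspace X `&` h @^-1` B).
Proof.
move=> [_ hc].
have [s0 sC sU] := smallest_sigma_algebra (mem_fspace X) (open_fspace X).
have -> : measurable = <<s @RGenOInfty.G R >> := RGenOInfty.measurableE R.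
move: B; apply: smallest_sub.
  split=> [|A hA|F hF] /=.
  - by rewrite preimage_set0 setI0.
  - have -> : mem_fspace X `&` h @^-1` (setT `\` A) =
        mem_fspace X `\` (mem_fspace X `&` h @^-1` A).
      apply/seteqP; split=> f [fX] /=; first by move=> [_ nA]; split=> // -[].
      by move=> nA; split=> //; split=> // Af; apply: nA.
    exact: sC.
  - by rewrite preimage_bigcup setI_bigcupr; exact: sU.
move=> _ [a ->] /=; apply: borel_fspace_open; split; first exact: subIsetl.
move=> f [fX /=]; rewrite in_itv/= andbT => af.
have [r r0 hr] := hc f fX (h f - a) ltac:(by rewrite subr_gt0).
exists r => // g gX gf; split=> //=; rewrite in_itv/= andbT.
have := hr g gX gf; rewrite ltr_norml => /andP[+ _]; lra.
Qed.

Lemma random_element_preimage d (T : measurableType d) (Z : T -> R -> R)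
    (h : (R -> R) -> R) (B : set R) :
  random_element X Z ->
  (fun w => h (Z w)) @^-1` B = Z @^-1` (mem_fspace X `&` h @^-1` B).
Proof. by move=> [ZX _]; apply/seteqP; split=> w /= => [|[]]. Qed.

Lemma bounded_measurable_comp d (T : measurableType d) (Z : T -> R -> R)
    (h : (R -> R) -> R) :
  random_element X Z -> bounded_continuous X h ->
  bounded_measurable R d T (fun w => h (Z w)).
Proof.
move=> Zr hbc; have [ZX Zm] := Zr; split.
  move=> _ B mB; rewrite setTI (random_element_preimage _ _ _ _ _ Zr).
  by apply: Zm; exact: borel_fspace_preimage.
by have [[M hM] _] := hbc; exists M => w; exact: hM.
Qed.

Lemma borel_fspace_far (c : R -> R) (e : R) : mem_fspace X c ->
  borel_fspace X [set f | mem_fspace X f /\ (e%:E < fdist X f c)%E].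
Proof.
move=> cX; apply: borel_fspace_open; split; first by move=> f [].
move=> f [fX]; rewrite fdistE// lte_fin => ef.
exists (rdist X f c - e); first by rewrite subr_gt0.
move=> g gX; rewrite fdistE// lte_fin => gf; split=> //.
have := rdist_triangle X f g c fX gX cX.
by rewrite fdistE// lte_fin (rdistC _ f g); lra.
Qed.

(** The complement of a closure is open.  This makes the event of leaving the
    closure of D measurable, so that its probability depends only on the law. *)
Lemma borel_fspace_inaccessible (D : nat -> R -> R) :
  (forall n, mem_fspace X (D n)) ->
  borel_fspace X [set f | mem_fspace X f /\
    exists2 e : R, 0 < e & forall n, (e%:E <= fdist X f (D n))%E].
Proof.
move=> DX; apply: borel_fspace_open; split; first by move=> f [].
move=> f [fX [e e0 fD]]; exists (e / 2); first by rewrite divr_gt0.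
move=> g gX; rewrite fdistE// lte_fin => gf; split=> //.
exists (e / 2); first by rewrite divr_gt0.
move=> n; have := fD n; rewrite !fdistE// !lee_fin => fDn.
have := rdist_triangle X f g (D n) fX gX (DX n).
by rewrite (rdistC _ f g); lra.
Qed.

End borel.

(** * Outer expectations *)

Section outer_expectation.
Context {R : realType} {d : measure_display} {T : measurableType d}.
Variable P : probability T R.
Local Notation bmf := (bounded_measurable R d T).

(** The upper bound holds because F + G is an integrable majorant of H, the lower
    one because every integrable majorant of H is above F - G. *)
Lemma outer_expectation_close (H F G : T -> R) : bmf F -> bmf G ->
  (forall w, `|H w - F w| <= G w) ->
  ((Rintegral P setT F - Rintegral P setT G)%:E <= outer_expectation P H <=
   (Rintegral P setT F + Rintegral P setT G)%:E)%E.
Proof.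
move=> bF bG HFG.
have EE f : bmf f -> ('E_P[f] = (Rintegral P setT f)%:E)%E.
  move=> bf; rewrite unlock /Rintegral fineK//.
  exact/integrable_fin_num/bounded_measurable_integrable.
apply/andP; split; last first.
  apply: ereal_inf_lbound; exists (fun w => F w + G w).
    split; first by apply: bounded_measurable_integrable;
      exact: bounded_measurableD.
    by move=> w; have := HFG w; rewrite ler_norml; lra.
  by rewrite EE ?meanD//; exact: bounded_measurableD.
apply: le_ereal_inf_tmp => _ [g [ig Hg] <-].
rewrite -meanB// -EE; last exact: bounded_measurableB.
rewrite unlock; apply: le_integral => //.
  by apply: bounded_measurable_integrable; exact: bounded_measurableB.
move=> w _; rewrite lee_fin (le_trans _ (Hg w))//.
by have := HFG w; rewrite ler_norml; lra.
Qed.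

Lemma outer_expectation_measurable (F : T -> R) : bmf F ->
  outer_expectation P F = (Rintegral P setT F)%:E.
Proof.
move=> bF; have :=
  outer_expectation_close F F (fun=> 0) bF (bounded_measurable_cst 0).
move=> /(_ (fun w => ltac:(by rewrite subrr normr0))).
by rewrite mean_cst subr0 addr0 => h; apply/eqP; rewrite eq_le andbC.
Qed.

Lemma mean_bounded_cvg0 (g : nat -> T -> R) : (forall n, bmf (g n)) ->
  (forall n w, `|g n w| <= 1) -> {ae P, forall w, g n w @[n --> \oo] --> (0 : R)} ->
  Rintegral P setT (g n) @[n --> \oo] --> (0 : R).
Proof.
move=> bg g1 g0.
have [] // := @dominated_convergence _ T R P setT measurableT
  (fun n w => (g n w)%:E) (fun=> 0%E) (fun=> 1%E)
  (fun n => measurable_int _ (bounded_measurable_integrable P _ (bg n)))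
  (measurable_cst _) _
  (bounded_measurable_integrable P _ (bounded_measurable_cst 1)) _.
- apply: filterS g0 => w gw _; apply/fine_cvgP; split => //.
  exact: nearW.
- by apply: aeW => w n _ /=; rewrite lee_fin.
by rewrite integral0 => _ _ h; exact: (fine_cvg h).
Qed.

End outer_expectation.

(** * Approximation by sums of products *)

Lemma bounded_continuousM {R : realType} (X : fspace R) (h h' : (R -> R) -> R) :
  bounded_continuous X h -> bounded_continuous X h' ->
  bounded_continuous X (fun f => h f * h' f).
Proof.
move=> [[M hM] hc] [[M' hM'] hc']; split.
  by exists (M * M') => f fX; rewrite normrM ler_pM ?hM ?hM'.
move=> f fX e e0.
have M0 : 0 <= M by exact: le_trans (hM f fX).
have M'0 : 0 <= M' by exact: le_trans (hM' f fX).
pose e' := e / (M + M' + 1).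
have e'0 : 0 < e' by rewrite divr_gt0// ltr_wpDl// addr_ge0.
have [r r0 hr] := hc f fX e' e'0; have [r' r'0 hr'] := hc' f fX e' e'0.
exists (Num.min r r'); first by rewrite lt_min r0 r'0.
move=> g gX gf.
have gr : `|h g - h f| < e'.
  by apply: hr => //; rewrite (lt_le_trans gf)// lee_fin ge_min lexx.
have gr' : `|h' g - h' f| < e'.
  by apply: hr' => //; rewrite (lt_le_trans gf)// lee_fin ge_min lexx orbT.
have -> : h g * h' g - h f * h' f =
  h g * (h' g - h' f) + (h g - h f) * h' f by ring.
have ee : e' * (M + M' + 1) = e by rewrite divfK// gt_eqF// ltr_wpDl// addr_ge0.
apply: (@le_lt_trans _ _ (M * e' + e' * M')).
  rewrite (le_trans (ler_normD _ _))// !normrM.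
  by rewrite lerD// ler_pM// ?hM ?hM' ?(ltW gr) ?(ltW gr').
by rewrite -ee; nra.
Qed.

Section tensor_span.
Context {R : realType} (X : fspace R) (k : nat).
Local Notation Xk := ('I_k -> R -> R).

(** The algebra generated by the bounded continuous functions of one coordinate.
    Independence gives access to the means of its members only. *)
Definition tensor_span (F : Xk -> R) : Prop :=
  exists (J : finType) (c : J -> R) (phi : J -> 'I_k -> (R -> R) -> R),
    (forall j i, bounded_continuous X (phi j i)) /\
    F = fun f => \sum_j c j * \prod_i phi j i (f i).

Lemma tensor_span_prod (phi : 'I_k -> (R -> R) -> R) :
  (forall i, bounded_continuous X (phi i)) ->
  tensor_span (fun f => \prod_i phi i (f i)).
Proof.
move=> bphi; exists unit, (fun=> 1), (fun=> phi); split=> //.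
by apply/funext => f; rewrite (big_pred1 tt) ?mul1r// => -[].
Qed.

Lemma tensor_spanZ (a : R) F : tensor_span F -> tensor_span (fun f => a * F f).
Proof.
move=> [J [c [phi [bphi ->]]]]; exists J, (fun j => a * c j), phi; split=> //.
by apply/funext => f; rewrite mulr_sumr; apply: eq_bigr => j _; rewrite mulrA.
Qed.

Lemma tensor_span_cst (a : R) : tensor_span (fun=> a).
Proof.
have := tensor_spanZ a _ (tensor_span_prod (fun _ _ => 1)
  (fun=> bounded_continuous_cst X 1)).
by congr tensor_span; apply/funext => f; rewrite big1// mulr1.
Qed.

Lemma tensor_spanD F G : tensor_span F -> tensor_span G ->
  tensor_span (fun f => F f + G f).
Proof.
move=> [J [c [phi [bphi ->]]]] [J' [c' [phi' [bphi' ->]]]].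
exists (J + J')%type,
  (fun j => match j with inl j => c j | inr j => c' j end),
  (fun j => match j with inl j => phi j | inr j => phi' j end).
by split=> [[]//|]; apply/funext => f; rewrite big_sumType.
Qed.

Lemma tensor_spanM F G : tensor_span F -> tensor_span G ->
  tensor_span (fun f => F f * G f).
Proof.
move=> [J [c [phi [bphi ->]]]] [J' [c' [phi' [bphi' ->]]]].
exists (J * J')%type, (fun j => c j.1 * c' j.2),
  (fun j i f => phi j.1 i f * phi' j.2 i f); split=> [j i|].
  exact: bounded_continuousM.
apply/funext => f; rewrite big_distrlr pair_big; apply: eq_bigr => j _ /=.
by rewrite big_split/= mulrACA.
Qed.

Lemma tensor_spanB F G : tensor_span F -> tensor_span G ->
  tensor_span (fun f => F f - G f).
Proof.
move=> tF tG; have := tensor_spanD _ _ tF (tensor_spanZ (-1) _ tG).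
by congr tensor_span; apply/funext => f; rewrite mulN1r.
Qed.

End tensor_span.

Section approximation.
Context {R : realType} (X : fspace R) (k : nat).
Local Notation Xk := ('I_k -> R -> R).
Variables (H : Xk -> R) (M : R) (D : nat -> R -> R).
Hypothesis HM : forall f : Xk, (forall i, mem_fspace X (f i)) -> `|H f| <= M.
Hypothesis Hc : forall f : Xk, (forall i, mem_fspace X (f i)) ->
  forall e : R, 0 < e -> exists2 r : R, 0 < r &
    forall g : Xk, (forall i, mem_fspace X (g i)) ->
      (forall i, rdist X (g i) (f i) < r) -> `|H g - H f| < e.
Hypothesis DX : forall n, mem_fspace X (D n).
Variable e : R.
Hypothesis e0 : 0 < e.

Definition in_closure (f : R -> R) : Prop :=
  forall r : R, 0 < r -> exists n, rdist X f (D n) < r.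

(** A cell is a product of balls: a tuple of centres taken from D, given by their
    indices, and a common radius.  Cells form a countable family. *)
Definition cell_radius (q : nat) : R := q.+1%:R^-1.

Lemma cell_radius_gt0 q : 0 < cell_radius q. Proof. by rewrite invr_gt0 ltr0n. Qed.

Definition cell_centre (a : {ffun 'I_k -> nat}) : Xk := fun i => D (a i).

(** The factor 2 is the one by which the support of a bump exceeds the ball on
    which it is 1. *)
Definition small_oscillation (a : {ffun 'I_k -> nat}) (q : nat) : Prop :=
  forall f : Xk, (forall i, mem_fspace X (f i)) ->
    (forall i, rdist X (f i) (cell_centre a i) < 2 * cell_radius q) ->
      `|H f - H (cell_centre a)| <= e.

(** An enumeration of the cells on which H is almost constant; the indices that
    do not code such a cell give None. *)
Definition cell (j : nat) : option ({ffun 'I_k -> nat} * nat) :=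
  if unpickle j is Some p then
    if `[< small_oscillation p.1 p.2 >] then Some p else None
  else None.

Definition cell_bump (j : nat) (f : Xk) : R :=
  if cell j is Some p then
    \prod_i bump X (cell_centre p.1 i) (cell_radius p.2) (f i) else 0.

Definition cell_value (j : nat) : R :=
  if cell j is Some p then H (cell_centre p.1) else 0.

Lemma cell_bump_span j : tensor_span X k (cell_bump j).
Proof.
rewrite /cell_bump; case: (cell j) => [p|]; last exact: tensor_span_cst.
apply: (tensor_span_prod X k (fun i =>
  bump X (cell_centre p.1 i) (cell_radius p.2))) => i.
by apply: bounded_continuous_bump; [exact: cell_radius_gt0|exact: DX].
Qed.

Lemma cell_bump_itv j f : 0 <= cell_bump j f <= 1.
Proof.
rewrite /cell_bump; case: (cell j) => [p|]; last by rewrite lexx ler01.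
apply/andP; split; first (apply: prodr_ge0 => i _).
  by case/andP: (bump_itv X (cell_centre p.1 i) (cell_radius p.2) (f i)).
by apply: prodr_ile1 => i _; exact: bump_itv.
Qed.

Lemma cell_bump_value j f : (forall i, mem_fspace X (f i)) -> cell_bump j f != 0 ->
  `|H f - cell_value j| <= e.
Proof.
move=> fX; rewrite /cell_bump /cell_value /cell; case: (unpickle j) => [p|];
  last by rewrite eqxx.
case: asboolP => [gp|_]; last by rewrite eqxx.
move=> /prodf_neq0 bf; apply: gp => // i.
by apply: bump_neq0; [exact: cell_radius_gt0|exact: bf].
Qed.

(** Choose a cell of radius less than a third of a radius of continuity at f,
    with centres that close to f: it has small oscillation and its bump is 1 at
    f. *)
Lemma cell_bump_cover f : (forall i, mem_fspace X (f i)) ->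
  (forall i, in_closure (f i)) ->
  exists j, cell_bump j f = 1.
Proof.
move=> fX fD; have [r r0 hr] := Hc f fX (e / 2) ltac:(by rewrite divr_gt0).
have [q hq] : exists q, 3 * cell_radius q < r.
  exists (Num.truncn (3 / r)); rewrite /cell_radius.
  by rewrite ltr_pdivrMr ?ltr0n// mulrC -ltr_pdivrMr// truncnS_gt.
have /choice[n hn] : forall i, exists n, rdist X (f i) (D n) < cell_radius q.
  by move=> i; apply: fD; exact: cell_radius_gt0.
pose a : {ffun 'I_k -> nat} := [ffun i => n i].
have fa i : rdist X (f i) (cell_centre a i) < cell_radius q.
  by rewrite /cell_centre ffunE.
have cX i : mem_fspace X (cell_centre a i) by exact: DX.
have aq : small_oscillation a q.
  move=> g gX ga.
  have h1 : `|H g - H f| < e / 2.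
    apply: hr => // i.
    have := rdist_triangle X (g i) (cell_centre a i) (f i) (gX i) (cX i) (fX i).
    by have := ga i; have := fa i; rewrite (rdistC _ (f i)); lra.
  have h2 : `|H (cell_centre a) - H f| < e / 2.
    apply: hr => // i; have := fa i; rewrite rdistC.
    by have := cell_radius_gt0 q; lra.
  by move: h1 h2; rewrite ler_norml !ltr_norml; lra.
exists (pickle (a, q)); rewrite /cell_bump /cell pickleK /=.
case: asboolP => // _; rewrite big1// => i _.
by apply: bump1; [exact: cell_radius_gt0|exact/ltW].
Qed.

(** The functions cell_bump N * partition_remainder N form a partition of unity on
    the set covered by the cells: their sum over the first N indices is
    1 - partition_remainder N. *)
Fixpoint partition_remainder (N : nat) (f : Xk) : R :=
  if N is N'.+1 then partition_remainder N' f * (1 - cell_bump N' f) else 1.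

(** H with its values on each piece of the partition replaced by the value at the
    centre of the cell. *)
Fixpoint partition_sum (N : nat) (f : Xk) : R :=
  if N is N'.+1 then
    partition_sum N' f + cell_value N' * (cell_bump N' f * partition_remainder N' f)
  else 0.

Lemma partition_remainder_span N : tensor_span X k (partition_remainder N).
Proof.
elim: N => [|N IH] /=; first exact: tensor_span_cst.
apply: tensor_spanM => //; apply: (tensor_spanB _ _ (fun=> 1)) => //.
  exact: tensor_span_cst.
exact: cell_bump_span.
Qed.

Lemma partition_sum_span N : tensor_span X k (partition_sum N).
Proof.
elim: N => [|N IH] /=; first exact: tensor_span_cst.
apply: tensor_spanD => //; apply: tensor_spanZ; apply: tensor_spanM.
  exact: cell_bump_span.
exact: partition_remainder_span.
Qed.

Lemma partition_remainder_itv N f : 0 <= partition_remainder N f <= 1.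
Proof.
elim: N => [|N /andP[IH0 IH1]] /=; first by rewrite lexx ler01.
have /andP[p0 p1] := cell_bump_itv N f.
by rewrite mulr_ge0 ?mulr_ile1 ?subr_ge0 ?gerBl.
Qed.

(** The first N pieces carry the weight 1 - partition_remainder N, on which the
    error is at most e; on the remaining weight H is bounded by M. *)
Lemma partition_sum_close N f : (forall i, mem_fspace X (f i)) ->
  `|H f - partition_sum N f| <= e + M * partition_remainder N f.
Proof.
move=> fX.
have : `|H f * (1 - partition_remainder N f) - partition_sum N f| <=
    e * (1 - partition_remainder N f).
  elim: N => [|N IH] /=; first by rewrite subrr !mulr0 subr0 normr0.
  have /andP[r0 r1] := partition_remainder_itv N f.
  have /andP[p0 p1] := cell_bump_itv N f.
  set r := partition_remainder N f in IH r0 r1 *.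
  set s := partition_sum N f in IH *.
  have -> : H f * (1 - r * (1 - cell_bump N f)) -
      (s + cell_value N * (cell_bump N f * r)) =
    (H f * (1 - r) - s) + (H f - cell_value N) * (cell_bump N f * r) by ring.
  have -> : e * (1 - r * (1 - cell_bump N f)) =
    e * (1 - r) + e * (cell_bump N f * r) by ring.
  rewrite (le_trans (ler_normD _ _))// lerD// normrM (ger0_norm (mulr_ge0 p0 r0)).
  have [->|pn0] := eqVneq (cell_bump N f) 0; first by rewrite mul0r !mulr0.
  by rewrite ler_wpM2r ?mulr_ge0//; exact: cell_bump_value.
have /andP[r0 r1] := partition_remainder_itv N f.
set r := partition_remainder N f in r0 r1 *; set s := partition_sum N f => h.
have -> : H f - s = (H f * (1 - r) - s) + H f * r by ring.
rewrite (le_trans (ler_normD _ _))// lerD//.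
  by rewrite (le_trans h)// ler_piMr ?(ltW e0)// gerBl.
by rewrite normrM (ger0_norm r0) ler_wpM2r// HM.
Qed.

Lemma partition_remainder_cvg0 f : (forall i, mem_fspace X (f i)) ->
  (forall i, in_closure (f i)) ->
  partition_remainder N f @[N --> \oo] --> (0 : R).
Proof.
move=> fX fD; have [j jf] := cell_bump_cover f fX fD.
apply: cvg_near_cst; exists j.+1 => // N /= jN.
elim: N jN => // N IH; rewrite ltnS leq_eqVlt => /predU1P[jN|/IH h] /=.
  by rewrite -jN jf subrr mulr0.
by rewrite h mul0r.
Qed.

End approximation.

(** * Joint weak convergence of independent random elements *)

(** The part of the measurability of a random element that weak convergence uses.
    It is visibly stable under the affine rescaling of an estimator. *)
Definition test_measurable (R : realType) (X : fspace R) (d : measure_display)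
    (T : measurableType d) (Z : T -> R -> R) : Prop :=
  (forall w, mem_fspace X (Z w)) /\
  forall h, bounded_continuous X h -> bounded_measurable R d T (fun w => h (Z w)).

Section joint_weak_convergence.
Context {R : realType} (X : fspace R) (k : nat).
Local Notation Xk := ('I_k -> R -> R).
Context {d d' : measure_display} {T : measurableType d} {T' : measurableType d'}.
Variables (P : probability T R) (P' : probability T' R).
Variables (V : nat -> 'I_k -> T -> R -> R) (Y : 'I_k -> T' -> R -> R).
Hypothesis VX : forall n i, test_measurable R X _ _ (V n i).
Hypothesis YX : forall i, test_measurable R X _ _ (Y i).
Hypothesis VY : forall phi : 'I_k -> (R -> R) -> R,
  (forall i, bounded_continuous X (phi i)) ->
  Rintegral P setT (fun w => \prod_i phi i (V n i w)) @[n --> \oo] -->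
  Rintegral P' setT (fun w => \prod_i phi i (Y i w)).

Lemma bounded_measurable_tensor_span (F : Xk -> R)
    (d0 : measure_display) (U : measurableType d0)
    (W : 'I_k -> U -> R -> R) : (forall i, test_measurable R X _ _ (W i)) ->
  tensor_span X k F -> bounded_measurable R d0 U (fun w => F (fun i => W i w)).
Proof.
move=> WX [J [c [phi [bphi ->]]]].
apply: bounded_measurable_sum => j; apply: bounded_measurableM;
  first exact: bounded_measurable_cst.
by apply: bounded_measurable_prod => i; exact: (WX i).2.
Qed.

Lemma cvg_tensor_span (F : Xk -> R) : tensor_span X k F ->
  Rintegral P setT (fun w => F (fun i => V n i w)) @[n --> \oo] -->
  Rintegral P' setT (fun w => F (fun i => Y i w)).
Proof.
move=> [J [c [phi [bphi ->]]]].
have E d0 (U : measurableType d0) (Q : probability U R) (W : 'I_k -> U -> R -> R) :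
    (forall i, test_measurable R X _ _ (W i)) ->
    Rintegral Q setT (fun w => \sum_j c j * \prod_i phi j i (W i w)) =
    \sum_j c j * Rintegral Q setT (fun w => \prod_i phi j i (W i w)).
  move=> WX.
  have bj j : bounded_measurable R d0 U (fun w => \prod_i phi j i (W i w)).
    by apply: bounded_measurable_prod => i; exact: (WX i).2.
  rewrite mean_sum => [|j]; last by apply: bounded_measurableM => //;
    exact: bounded_measurable_cst.
  by apply: eq_bigr => j _; rewrite meanZ.
rewrite E//; under eq_fun => n do rewrite E//.
apply: cvg_big => [|j _]; first exact: add_continuous.
by apply: cvgM; [exact: cvg_cst|exact: VY].
Qed.

Variables (H : Xk -> R) (M : R) (D : nat -> R -> R).
Hypothesis HM : forall f : Xk, (forall i, mem_fspace X (f i)) -> `|H f| <= M.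
Hypothesis Hc : forall f : Xk, (forall i, mem_fspace X (f i)) ->
  forall e : R, 0 < e -> exists2 r : R, 0 < r &
    forall g : Xk, (forall i, mem_fspace X (g i)) ->
      (forall i, rdist X (g i) (f i) < r) -> `|H g - H f| < e.
Hypothesis DX : forall n, mem_fspace X (D n).
Hypothesis YD : {ae P', forall w, forall i, in_closure X D (Y i w)}.

(** Both outer expectations lie between the means of F - G and F + G, where F and
    G are sums of products and G has a small mean under the limit; the means of F
    and G converge by [cvg_tensor_span]. *)
Lemma cvg_outer_expectation :
  outer_expectation P (fun w => H (fun i => V n i w)) @[n --> \oo] -->
  outer_expectation P' (fun w => H (fun i => Y i w)).
Proof.
have M0 : 0 <= M.
  by apply: le_trans (HM (fun i => Y i point) _) => // i; case: (YX i).
have approx (e : R) : 0 < e -> exists F G : Xk -> R,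
    [/\ tensor_span X k F, tensor_span X k G,
        forall f, (forall i, mem_fspace X (f i)) -> `|H f - F f| <= G f &
        Rintegral P' setT (fun w => G (fun i => Y i w)) < e].
  move=> e0; pose e' := e / 2; have e'0 : 0 < e' by rewrite divr_gt0.
  pose RN := partition_remainder X k H D e'.
  have bRN N : bounded_measurable R d' T' (fun w => RN N (fun i => Y i w)).
    by apply: bounded_measurable_tensor_span => //; apply: partition_remainder_span.
  have : Rintegral P' setT (fun w => RN N (fun i => Y i w)) @[N --> \oo] -->
      (0 : R).
    apply: mean_bounded_cvg0 => //.
      move=> N w.
      have /andP[r0 r1] := partition_remainder_itv X k H D e' N (fun i => Y i w).
      by rewrite ger0_norm.
    apply: filterS YD => w YDw.
    by apply: (partition_remainder_cvg0 X k H D) => // i; case: (YX i).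
  have e'M : 0 < e' / (M + 1) by rewrite divr_gt0// ltr_wpDl.
  move=> /cvgrPdist_lt/(_ _ e'M)[N _ /(_ N (leqnn N))] /=.
  rewrite sub0r normrN => RNe.
  exists (partition_sum X k H D e' N), (fun f => e' + M * RN N f); split.
  - exact: partition_sum_span.
  - apply: tensor_spanD; first exact: tensor_span_cst.
    by apply: tensor_spanZ; exact: partition_remainder_span.
  - by move=> f fX; exact: partition_sum_close.
  rewrite meanD; [|exact: bounded_measurable_cst|by
    apply: bounded_measurableM => //; exact: bounded_measurable_cst].
  rewrite mean_cst meanZ// /e' [ltRHS](splitr e) ltrD2l -/e'.
  move: RNe; rewrite ltr_pdivlMr ?ltr_wpDl// => RNe.
  apply: le_lt_trans RNe; rewrite mulrC.
  apply: le_trans (ler_norm _) _; rewrite normrM.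
  by rewrite ler_wpM2l// ger0_norm// lerDl.
have bnd d0 (U : measurableType d0) (Q : probability U R) (W : 'I_k -> U -> R -> R)
    (F G : Xk -> R) : (forall i, test_measurable R X _ _ (W i)) ->
    tensor_span X k F -> tensor_span X k G ->
    (forall f, (forall i, mem_fspace X (f i)) -> `|H f - F f| <= G f) ->
    outer_expectation Q (fun w => H (fun i => W i w)) \is a fin_num /\
    `|fine (outer_expectation Q (fun w => H (fun i => W i w))) -
      Rintegral Q setT (fun w => F (fun i => W i w))| <=
    Rintegral Q setT (fun w => G (fun i => W i w)).
  move=> WX tF tG HFG.
  have /andP[] := outer_expectation_close Q (fun w => H (fun i => W i w)) _ _
    (bounded_measurable_tensor_span _ _ _ _ WX tF)
    (bounded_measurable_tensor_span _ _ _ _ WX tG)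
    (fun w => HFG _ (fun i => (WX i).1 w)).
  case: (outer_expectation _ _) => [r| |] //=.
  by rewrite !lee_fin => h1 h2; split=> //; rewrite ler_norml; lra.
have [F1 [G1 [tF1 tG1 FG1 _]]] := approx 1 ltr01.
have [Yfin _] := bnd _ _ P' Y F1 G1 YX tF1 tG1 FG1.
rewrite -(fineK Yfin); apply/fine_cvgP; split.
  by apply: nearW => n; case: (bnd _ _ P (V n) F1 G1 (VX n) tF1 tG1 FG1).
apply/cvgrPdist_le => e e0; have e40 : 0 < e / 4 by rewrite divr_gt0.
have [F [G [tF tG FG GYe]]] := approx (e / 4) e40.
have [_ hY] := bnd _ _ P' Y F G YX tF tG FG.
have /cvgrPdist_le/(_ _ e40) cF := cvg_tensor_span _ tF.
have /cvgrPdist_le/(_ _ e40) cG := cvg_tensor_span _ tG.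
near=> n.
have [_ hV] := bnd _ _ P (V n) F G (VX n) tF tG FG.
have hF : `|Rintegral P' setT (fun w => F (fun i => Y i w)) -
   Rintegral P setT (fun w => F (fun i => V n i w))| <= e / 4 by near: n.
have hG : `|Rintegral P' setT (fun w => G (fun i => Y i w)) -
   Rintegral P setT (fun w => G (fun i => V n i w))| <= e / 4 by near: n.
move: GYe hY hV hF hG; rewrite /= !ler_norml; lra.
Unshelve. all: by end_near. Qed.

End joint_weak_convergence.

(** An instance of [mean_prod_indep] whose pi-systems are the sigma-algebras that
    the random elements generate. *)
Lemma mean_prod_random_elements {R : realType} (X : fspace R)
    {d : measure_display} {T : measurableType d} (P : probability T R) (k : nat)
    (Y : 'I_k -> T -> R -> R) (phi : 'I_k -> (R -> R) -> R) :
  (forall i, random_element X (Y i)) -> independent P (borel_fspace X) Y ->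
  (forall i, bounded_continuous X (phi i)) ->
  Rintegral P setT (fun w => \prod_i phi i (Y i w)) =
  \prod_i Rintegral P setT (fun w => phi i (Y i w)).
Proof.
move=> rY indY bphi.
apply: (mean_prod_indep P 'I_k (fun i => [set Y i @^-1` B | B in borel_fspace X])
  (fun i w => phi i (Y i w))).
- move=> i; have [YX Ym] := rY i; split.
  + exists (mem_fspace X); first exact: borel_fspace_mem.
    by apply/seteqP; split=> // w _; exact: YX.
  + move=> _ _ [B bB <-] [C bC <-]; exists (B `&` C); last by rewrite preimage_setI.
    exact: setI_borel_fspace.
  + by move=> _ [B bB <-]; exact: Ym.
- move=> A hA.
  have /choice[B hB] : forall i, exists B, borel_fspace X B /\ A i = Y i @^-1` B.
    by move=> i; have [B bB <-] := hA i; exists B.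
  have bB i : borel_fspace X (B i) by case: (hB i).
  have AE i : A i = Y i @^-1` B i by case: (hB i).
  have -> : \bigcap_i A i = \bigcap_(i in [set` index_enum 'I_k]) Y i @^-1` B i.
    apply/seteqP; split=> w h i _.
      by rewrite -AE; exact: h.
    by rewrite AE; apply: h => /=; rewrite mem_index_enum.
  rewrite indY ?index_enum_uniq// fine_prode => [|i].
    by apply: eq_bigr => i _; rewrite AE.
  by apply: fin_num_measure; exact: (rY i).2.
- by move=> i; exact: bounded_measurable_comp.
- move=> i B mB; rewrite (random_element_preimage _ _ _ _ _ _ (rY i)).
  apply: sub_sigma_algebra; exists (mem_fspace X `&` phi i @^-1` B) => //.
  exact: borel_fspace_preimage.
Qed.

(** The event of leaving the closure of D is a Borel event, so it is negligible
    for Z because it is for Y. *)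
Lemma ae_in_closure {R : realType} (X : fspace R) (D : nat -> R -> R)
    {d : measure_display} {T : measurableType d} (P : probability T R)
    {d' : measure_display} {T' : measurableType d'} (P' : probability T' R)
    (Y : T -> R -> R) (Z : T' -> R -> R) :
  random_element X Y -> random_element X Z -> (forall n, mem_fspace X (D n)) ->
  (forall B, borel_fspace X B -> P' (Z @^-1` B) = P (Y @^-1` B)) ->
  {ae P, forall w, forall e : R, 0 < e ->
    exists n, (fdist X (Y w) (D n) < e%:E)%E} ->
  {ae P', forall w, in_closure X D (Z w)}.
Proof.
move=> [YX Ym] [ZX Zm] DX law aeY.
set bad := [set f | mem_fspace X f /\
    exists2 e : R, 0 < e & forall n, (e%:E <= fdist X f (D n))%E].
have bbad : borel_fspace X bad by exact: borel_fspace_inaccessible.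
exists (Z @^-1` bad); split; first exact: Zm.
  rewrite [LHS]law//; have [N [mN PN YN]] := aeY.
  apply/eqP; rewrite eq_le measure_ge0 andbT -PN.
  apply: le_measure; rewrite ?inE//; first exact: Ym.
  move=> w [_ [e e0 he]]; apply: YN => /= /(_ e e0)[n].
  by rewrite ltNge he.
move=> w /= nw; split; first exact: ZX.
apply: contrapT => h; apply: nw => r r0; apply: contrapT => hr; apply: h.
exists r => // n; rewrite leNgt; apply/negP; rewrite fdistE// lte_fin => hn.
by apply: hr; exists n.
Qed.

(** * The quantile of block estimators *)

Section main.
Context (R : realType) (X : fspace R) (theta0 : R -> R)
    (htheta0 : mem_fspace X theta0)
    (k : nat) (hk : (0 < k)%N)
    (alpha : R -> R) (halpha : forall x, x \in `[0, 1] -> 0 < alpha x < 1)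
    (dO : measure_display) (Omega : measurableType dO) (P : probability Omega R)
    (dS : measure_display) (S : measurableType dS)
    (xi : nat -> Omega -> S) (hxi : iid P measurable xi)
    (t : forall m, m.-tuple S -> R -> R)
    (ht : forall m, random_element X (t m))
    (b : forall n, 'I_k * 'I_(n %/ k) -> 'I_n)
    (hb : forall n, injective (b n)).

Definition block_index n (i : 'I_k) (j : 'I_(n %/ k)) : nat := b n (i, j).

Lemma block_index_inj n :
  injective (fun p : 'I_k * 'I_(n %/ k) => block_index n p.1 p.2).
Proof. by move=> [i j] [i' j'] /val_inj /hb. Qed.

Lemma block_index_inj1 n i : injective (block_index n i).
Proof. by move=> j j' e; have [] := @block_index_inj n (i, j) (i, j') e. Qed.

Lemma block_estimatorE n i w : block_estimator t xi b n i w =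
  t (n %/ k)%N (sub_sample xi (n %/ k) (block_index n i) w).
Proof. by []. Qed.

Lemma random_element_sub_sample m (c : 'I_m -> nat) :
  random_element X (fun w => t m (sub_sample xi m c w)).
Proof.
have [tX tm] := ht m; split=> [w|B bB]; first exact: tX.
have := measurable_sub_sample P xi hxi m c measurableT _ (tm B bB).
by rewrite setTI.
Qed.

Lemma mem_block_estimator n i w : mem_fspace X (block_estimator t xi b n i w).
Proof. by rewrite block_estimatorE; have [tX _] := ht (n %/ k)%N; exact: tX. Qed.

Lemma divn_cvg : (n %/ k)%N @[n --> \oo] --> \oo.
Proof.
move=> A [N _ NA]; exists (N * k)%N => // n /= Nn; apply: NA => /=.
by rewrite leq_divRL.
Qed.

(** If the quantile is at distance more than e from [theta0], then one of the k
    block estimators is at distance more than e / k. *)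
Lemma quantile_estimator_consistent : cvg_in_prob X P (estimator t xi) theta0 ->
  cvg_in_prob X P (quantile_estimator t xi b alpha) theta0.
Proof.
move=> hc e e0; pose e' := e / k%:R.
have k0 : 0 < k%:R :> R by rewrite ltr0n.
have e'0 : 0 < e' by rewrite divr_gt0.
pose bad := [set f | mem_fspace X f /\ (e'%:E < fdist X f theta0)%E].
have bbad : borel_fspace X bad by exact: borel_fspace_far.
pose u m := P [set w |
  (e'%:E < fdist X (t m (sub_sample xi m (@nat_of_ord m) w)) theta0)%E].
have preE m (c : 'I_m -> nat) :
    [set w | (e'%:E < fdist X (t m (sub_sample xi m c w)) theta0)%E] =
    (fun w => t m (sub_sample xi m c w)) @^-1` bad.
  by apply/seteqP; split=> w /= => [|[]//]; split=> //; case: (ht m).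
have mpre m (c : 'I_m -> nat) :
    measurable [set w | (e'%:E < fdist X (t m (sub_sample xi m c w)) theta0)%E].
  by rewrite preE; exact: (random_element_sub_sample m c).2.
have cu : u m @[m --> \oo] --> 0%E.
  have := hc e' e'0; apply: cvg_trans; apply: near_eq_cvg; apply: nearW => m.
  by rewrite /u measurable_mu_extE//; exact: mpre.
have same n i :
    P [set w | (e'%:E < fdist X (block_estimator t xi b n i w) theta0)%E] =
    u (n %/ k)%N.
  rewrite /u preE -[LHS]/(P [set w | (e'%:E <
    fdist X (t (n %/ k)%N (sub_sample xi (n %/ k) (block_index n i) w)) theta0)%E]).
  rewrite preE.
  apply: (sub_sample_law P xi hxi _ _ _ (t (n %/ k)%N @^-1` bad)).
  - exact: block_index_inj1.
  - exact: val_inj.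
  - exact: (ht _).2.
have bound n : (mu_ext P [set w |
      (e%:E < fdist X (quantile_estimator t xi b alpha n w) theta0)%E]
    <= k%:R%:E * u (n %/ k)%N)%E.
  have msub i := mpre _ (block_index n i).
  have sub : [set w |
      (e%:E < fdist X (quantile_estimator t xi b alpha n w) theta0)%E] `<=`
      \big[setU/set0]_(i < k)
        [set w | (e'%:E < fdist X (block_estimator t xi b n i w) theta0)%E].
    move=> w /= ew; apply: contrapT => nw.
    have le_e' i : (fdist X (block_estimator t xi b n i w) theta0 <= e'%:E)%E.
      rewrite leNgt; apply/negP => h; apply: nw.
      by rewrite -bigcup_seq; exists i => //=; rewrite mem_index_enum.
    have := fdist_pquantile_cst X k hk alpha halpha _ theta0
      (fun i => mem_block_estimator n i w) htheta0.
    rewrite leNgt => /negP; apply; apply: le_lt_trans ew.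
    apply: (@le_trans _ _ (\sum_(i < k) e'%:E)%E); first exact: lee_sum.
    by rewrite sumEFin lee_fin sumr_const card_ord -mulr_natr divfK// gt_eqF.
  apply: (le_trans (le_mu_ext P sub)).
  have -> : (k%:R%:E * u (n %/ k)%N = \sum_(i < k) mu_ext P [set w |
      (e'%:E < fdist X (block_estimator t xi b n i w) theta0)%E])%E.
    rewrite [RHS](eq_bigr (fun=> u (n %/ k)%N)) => [|i _]; last first.
      by rewrite measurable_mu_extE; [exact: same|exact: msub].
    rewrite -[u _]fineK ?sumEFin ?sumr_const ?card_ord -?EFinM ?mulr_natl//.
    exact/fin_num_measure/mpre.
  (* finite subadditivity of the outer probability *)
  elim/big_rec2: _ => [|i y A _ IH]; first by rewrite mu_ext0.
  by apply: (le_trans (outer_measureU2 (mu_ext P) _ _)); rewrite leeD2l.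
apply: (@squeeze_cvge _ _ _ _ (fun=> 0%E) _ (fun n => k%:R%:E * u (n %/ k)%N)%E).
- by apply: nearW => n; rewrite bound andbT; exact: mu_ext_ge0.
- exact: cvg_cst.
- rewrite -[X in _ --> X](mule0 k%:R%:E); apply: cvgeZl => //.
  exact: (cvg_comp _ _ divn_cvg cu).
Qed.

(** The rescaled quantile estimator is, up to distance zero, the quantile of the
    rescaled block estimators; [cvg_outer_expectation] is applied to the
    composite of the test function with the quantile. *)
Lemma quantile_estimator_cvg_in_dist
    (hq : forall f : 'I_k -> R -> R, (forall i, mem_fspace X (f i)) ->
                  mem_fspace X (pquantile alpha f))
     (a : nat -> R) (ha0 : forall n, 0 <= a n)
     (dY : measure_display) (OmegaY : measurableType dY)
     (PY : probability OmegaY R) (Y : OmegaY -> R -> R)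
     (hY : random_element X Y)
     (hYsep : ~ separable X -> ae_separably_valued X PY Y)
     (dY' : measure_display) (OmegaY' : measurableType dY')
     (PY' : probability OmegaY' R) (Y' : 'I_k -> OmegaY' -> R -> R)
     (hY' : iid_copies X PY Y PY' Y') :
   cvg_in_dist X P (fun n w x => a n * (estimator t xi n w x - theta0 x)) PY Y ->
   cvg_in_dist X P
     (fun n w x => a (n %/ k)%N *
        (quantile_estimator t xi b alpha n w x - theta0 x))
     PY' (fun w => pquantile alpha (fun i => Y' i w)).
Proof.
move=> hc h hbc.
have [rY' lawY' indY'] := hY'.
have affX m f : mem_fspace X f -> mem_fspace X (fun x => a m * (f x - theta0 x)).
  move=> fX; have := mem_fspace_lin X (a m) (- a m) f theta0 fX htheta0.
  by congr mem_fspace; apply/funext => x; rewrite mulrBr mulNr.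
pose V n (i : 'I_k) w x :=
  a (n %/ k)%N * (block_estimator t xi b n i w x - theta0 x).
have VX n i : test_measurable R X _ _ (V n i).
  split=> [w|g gbc]; first exact/affX/mem_block_estimator.
  have := bounded_measurable_comp X _ _ _ _
    (random_element_sub_sample _ (block_index n i))
    (bounded_continuous_affine X g (a (n %/ k)%N) theta0 htheta0 gbc).
  exact.
have YX i : test_measurable R X _ _ (Y' i).
  split=> [w|g gbc]; first by case: (rY' i).
  exact: bounded_measurable_comp.
have VY (phi : 'I_k -> (R -> R) -> R) : (forall i, bounded_continuous X (phi i)) ->
    Rintegral P setT (fun w => \prod_i phi i (V n i w)) @[n --> \oo] -->
    Rintegral PY' setT (fun w => \prod_i phi i (Y' i w)).
  move=> bphi.
  pose psi m i (s : m.-tuple S) := phi i (fun x => a m * (t m s x - theta0 x)).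
  have bpsi m i : bounded_measurable R _ _ (psi m i).
    exact: (bounded_measurable_comp X _ _ _ _ (ht m)
      (bounded_continuous_affine X (phi i) (a m) theta0 htheta0 (bphi i))).
  pose v i m := Rintegral P setT (fun w =>
    psi m i (sub_sample xi m (@nat_of_ord m) w)).
  have -> : (fun n => Rintegral P setT (fun w => \prod_i phi i (V n i w))) =
      (fun n => \prod_i v i (n %/ k)%N).
    apply/funext => n; rewrite /v.
    rewrite [LHS](mean_prod_blocks P xi hxi 'I_k _ (block_index n)
      (psi (n %/ k)%N))//; last exact: block_index_inj.
    apply: eq_bigr => i _; apply: mean_sub_sample => //; last exact: val_inj.
    exact: block_index_inj1.
  rewrite (mean_prod_random_elements X)//.
  apply: cvg_big => [|i _]; first exact: mul_continuous.
  have -> : Rintegral PY' setT (fun w => phi i (Y' i w)) =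
      Rintegral PY setT (fun w => phi i (Y w)).
    apply: mean_eq_law;
      [exact: (YX i).2|exact: bounded_measurable_comp hY (bphi i)|].
    move=> B mB.
    rewrite (random_element_preimage _ _ _ _ _ _ (rY' i)).
    rewrite (random_element_preimage _ _ _ _ _ _ hY).
    by apply: lawY'; exact: borel_fspace_preimage.
  apply: (cvg_comp _ _ divn_cvg).
  have := hc (phi i) (bphi i).
  rewrite outer_expectation_measurable;
    last exact: bounded_measurable_comp hY (bphi i).
  move=> /fine_cvg; apply: cvg_trans; apply: near_eq_cvg; apply: nearW => m /=.
  rewrite outer_expectation_measurable//.
  have := bounded_measurable_comp X _ _ _ _
    (random_element_sub_sample m (@nat_of_ord m))
    (bounded_continuous_affine X (phi i) (a m) theta0 htheta0 (bphi i)).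
  exact.
(* a countable set whose closure carries the law of Y *)
have [D [DX hD]] : exists D : nat -> R -> R, (forall n, mem_fspace X (D n)) /\
    {ae PY, forall w, forall e : R, 0 < e ->
      exists n, (fdist X (Y w) (D n) < e%:E)%E}.
  have [[D [DX hD]]|/hYsep[D DX hD]] := pselect (separable X); last by exists D.
  by exists D; split=> //; apply: aeW => w; apply: hD; case: hY.
have YD : {ae PY', forall w, forall i, in_closure X D (Y' i w)}.
  apply: filter_forall => i.
  by apply: (ae_in_closure X D PY PY' Y (Y' i)) => // B; exact: lawY'.
have [[M hM] hcont] := hbc.
pose H (f : 'I_k -> R -> R) := h (pquantile alpha f).
have HM f : (forall i, mem_fspace X (f i)) -> `|H f| <= M.
  by move=> fX; apply: hM; exact: hq.
have Hc (f : 'I_k -> R -> R) : (forall i, mem_fspace X (f i)) ->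
    forall e : R, 0 < e -> exists2 r : R, 0 < r &
    forall g : 'I_k -> R -> R, (forall i, mem_fspace X (g i)) ->
      (forall i, rdist X (g i) (f i) < r) -> `|H g - H f| < e.
  move=> fX e e0; have [r r0 hr] := hcont _ (hq f fX) e e0.
  have k0 : 0 < k%:R :> R by rewrite ltr0n.
  exists (r / k%:R); first exact: divr_gt0.
  move=> g gX gf; apply: hr; first exact: hq.
  apply: (le_lt_trans (fdist_pquantile X k hk alpha halpha g f gX fX)).
  under eq_bigr do rewrite fdistE//.
  rewrite sumEFin lte_fin.
  have -> : r = \sum_(i < k) r / k%:R.
    by rewrite sumr_const card_ord -[_ *+ k]mulr_natr divfK// gt_eqF.
  apply: ltr_sum => //; apply/hasP; exists (Ordinal hk) => //.
have := cvg_outer_expectation X k P PY' V Y' VX YX VY H M D HM Hc DX YD.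
apply: cvg_trans; apply: near_eq_cvg; apply: nearW => n.
congr outer_expectation; apply/funext => w; rewrite /H.
apply: (bounded_continuous_eq X) => //.
- by apply: hq => i; exact/affX/mem_block_estimator.
- by apply: affX; apply: hq => i; exact: mem_block_estimator.
- rewrite fdistC; exact: fdist_pquantile_affine.
Qed.

End main.

Theorem theorem3p7 (R : realType) (X : fspace R) (theta0 : R -> R)
    (htheta0 : mem_fspace X theta0)
    (k : nat) (hk : (0 < k)%N)
    (alpha : R -> R) (halpha : forall x, x \in `[0, 1] -> 0 < alpha x < 1)
    (dO : measure_display) (Omega : measurableType dO) (P : probability Omega R)
    (dS : measure_display) (S : measurableType dS)
    (xi : nat -> Omega -> S) (hxi : iid P measurable xi)
    (t : forall m, m.-tuple S -> R -> R)
    (ht : forall m, random_element X (t m))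
    (b : forall n, 'I_k * 'I_(n %/ k) -> 'I_n)
    (hb : forall n, injective (b n)) :
  (cvg_in_prob X P (estimator t xi) theta0 ->
   cvg_in_prob X P (quantile_estimator t xi b alpha) theta0)
  /\
  (forall (hq : forall f : 'I_k -> R -> R, (forall i, mem_fspace X (f i)) ->
                  mem_fspace X (pquantile alpha f))
     (a : nat -> R) (ha0 : forall n, 0 <= a n)
     (ha : a n @[n --> \oo] --> +oo)
     (dY : measure_display) (OmegaY : measurableType dY)
     (PY : probability OmegaY R) (Y : OmegaY -> R -> R)
     (hY : random_element X Y)
     (hYsep : ~ separable X -> ae_separably_valued X PY Y)
     (dY' : measure_display) (OmegaY' : measurableType dY')
     (PY' : probability OmegaY' R) (Y' : 'I_k -> OmegaY' -> R -> R)
     (hY' : iid_copies X PY Y PY' Y'),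
   cvg_in_dist X P (fun n w x => a n * (estimator t xi n w x - theta0 x)) PY Y ->
   cvg_in_dist X P
     (fun n w x => a (n %/ k)%N *
        (quantile_estimator t xi b alpha n w x - theta0 x))
     PY' (fun w => pquantile alpha (fun i => Y' i w))).
Proof.
split; first exact: quantile_estimator_consistent.
move=> hq a ha0 ha dY OmegaY PY Y hY hYsep dY' OmegaY' PY' Y' hY'.
exact: quantile_estimator_cvg_in_dist.
Qed.
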